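(* Let $d\ge 2$ and $n\ge 2$ be integers. Suppose there exists $\theta_{d,n}\in\mathbb{R}$ such that for every $\varepsilon>0$ and every (absolutely) irreducible form $F\in\mathbb{Z}[X_0,\ldots,X_n]$ of degree $d$ one has $$N(F;B)=O_{d,\varepsilon,n}(B^{\theta_{d,n}+\varepsilon})\qquad (B\ge 1).$$ Then for every $\varepsilon>0$, every $N$, and every geometrically integral variety $Z\subset\mathbb{P}^N$ of degree $d$ and dimension $n-1$, one has $$N_Z(B)=O_{d,\varepsilon,N}(B^{\theta_{d,n}+\varepsilon})\qquad (B\ge 1).$$
   Context: ''Irreducible'' means absolutely irreducible and ''integral'' means geometrically integral. Varieties $Z\subset\mathbb{P}^N$ are proper subvarieties whose ideal is generated by forms with coefficients in $\overline{\mathbb{Q}}$. For $F\in\mathbb{Z}[X_0,\ldots,X_n]$, $N(F;B)=\#\{\mathbf{x}\in\mathbb{Z}^{n+1}: F(\mathbf{x})=0,\ \gcd(x_0,\ldots,x_n)=1,\ \max_i|x_i|\le B\}$. Every point $x\in\mathbb{P}^N(\mathbb{Q})$ is represented as $x=[\mathbf{x}]$ with $\mathbf{x}\in\mathbb{Z}^{N+1}$, $\gcd(x_0,\ldots,x_N)=1$, and its height is $H(x)=\max_i|x_i|$. For a variety $Z\subset\mathbb{P}^N$, $N_Z(B)=\#\{x\in Z\cap\mathbb{P}^N(\mathbb{Q}): H(x)\le B\}$. Subscripts on $O$ indicate the only quantities the implied constant may depend on. *)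

(* Defs.v *)
From mathcomp Require Import all_boot all_order all_algebra all_field.
From mathcomp Require Import finmap mpoly.
From mathcomp Require Import boolp classical_sets cardinality reals.

Set Implicit Arguments.
Unset Strict Implicit.
Unset Printing Implicit Defensive.

Import Order.TTheory GRing.Theory Num.Theory.
Local Open Scope ring_scope.

(* Throughout, [algC] plays the role of the algebraic closure of Q. *)

Definition irreducible_elt (A : idomainType) (p : A) : Prop :=
  [/\ p != 0, p \isn't a GRing.unit
    & forall a b : A, p = a * b -> a \is a GRing.unit \/ b \is a GRing.unit].

Definition abs_irreducible (n : nat) (F : {mpoly int[n]}) : Prop :=
  irreducible_elt (map_mpoly intr F : {mpoly algC[n]}).

Definition primitive (m : nat) (x : 'rV[int]_m) : bool :=
  \big[gcdn/0%N]_(i < m) `|x ord0 i|%N == 1%N.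

Definition height (m : nat) (x : 'rV[int]_m) : nat :=
  \max_(i < m) `|x ord0 i|%N.

Section Counting.
Local Open Scope classical_set_scope.

Lemma finite_height (R : realType) (m : nat) (B : R) :
  finite_set [set x : 'rV[int]_m | (height x)%:R <= B].
Proof.
pose b := Num.truncn B.
pose f (u : {ffun 'I_m -> 'I_(b + b).+1}) : 'rV[int]_m :=
  \row_i ((u i : nat)%:Z - b%:Z).
apply: (@sub_finite_set _ _ [set f u | u in [set: {ffun 'I_m -> 'I_(b + b).+1}]]);
  last exact/finite_image/finite_finset.
move=> x /= hx.
have hb i : (`|x ord0 i|%N <= b)%N.
  have h1 : (`|x ord0 i|%N <= height x)%N.
    by rewrite /height (bigD1 i) //= leq_maxl.
  apply: leq_trans h1 _.
  have B0 : 0 <= B by apply: le_trans hx; rewrite ler0n.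
  by rewrite /b truncn_ge_nat.
exists [ffun i => inord (absz (x ord0 i + b%:Z))] => //.
apply/rowP => i; rewrite !mxE ffunE.
have le_b : `|x ord0 i| <= b%:Z by rewrite -abszE lez_nat.
have [lo hi] : - b%:Z <= x ord0 i /\ x ord0 i <= b%:Z by apply/andP; rewrite -ler_norml.
have ge0 : 0 <= x ord0 i + b%:Z by rewrite -lerBlDr sub0r.
rewrite inordK; first by rewrite gez0_abs // addrK.
by rewrite ltnS -lez_nat gez0_abs // PoszD lerD2r.
Qed.

(* [fset_set] is only meaningful on finite sets; see [finite_height]. *)
Definition count_form (R : realType) (n : nat) (F : {mpoly int[n.+1]}) (B : R)
    : nat :=
  #|` fset_set [set x : 'rV[int]_n.+1 |
        [/\ F.@[x ord0] = 0, primitive x & (height x)%:R <= B]] |.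

End Counting.

(* A variety is given by its ideal, which is not required to be radical;
   [variety_proper] says that it is not the whole projective space. *)
Record variety (N : nat) := Variety {
  variety_ideal :> {pred {mpoly algC[N.+1]}};
  variety_forms : exists2 G : seq {mpoly algC[N.+1]},
    (forall g, g \in G -> exists e : nat, g \is e.-homog)
    & forall p, p \in variety_ideal <->
        exists c : nat -> {mpoly algC[N.+1]},
          p = \sum_(i < size G) c i * G`_i;
  variety_proper : exists2 p, p \in variety_ideal & p != 0
}.

(* The ground field being algebraically closed, geometrically integral means
   integral: the ideal is prime and does not contain the irrelevant ideal. *)
Definition geom_integral (N : nat) (Z : variety N) : Prop :=
  prime_idealr_closed Z /\ exists i : 'I_N.+1, 'X_i \notin Z.

Lemma variety_lin (N : nat) (Z : variety N) (a u v : {mpoly algC[N.+1]}) :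
  u \in Z -> v \in Z -> a * u + v \in Z.
Proof.
case: (variety_forms Z) => G _ genG /genG[c ->] /genG[c' ->].
apply/genG; exists (fun i => a * c i + c' i).
by rewrite mulr_sumr -big_split; apply: eq_bigr => i _; rewrite mulrDl mulrA.
Qed.

Lemma variety0 (N : nat) (Z : variety N) : 0 \in Z.
Proof.
case: (variety_forms Z) => G _ genG; apply/genG; exists (fun=> 0).
by rewrite big1 // => i _; rewrite mul0r.
Qed.

(* The space of forms of degree m in the ideal of Z; see [mem_ideal_part]. *)
Definition ideal_part (N : nat) (Z : variety N) (m : nat) :
    {vspace dhomog N.+1 algC m} :=
  xget 0%VS (fun V : {vspace dhomog N.+1 algC m} =>
    forall p, (p \in V) = (mpoly_of_dhomog p \in Z)).

Lemma mem_ideal_part (N : nat) (Z : variety N) (m : nat)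
    (p : dhomog N.+1 algC m) :
  (p \in ideal_part Z m) = (mpoly_of_dhomog p \in Z).
Proof.
suff [V VP] : exists V : {vspace dhomog N.+1 algC m},
    forall q, (q \in V) = (mpoly_of_dhomog q \in Z).
  rewrite /ideal_part; case: xgetP => [W _ WP|/(_ V)]; first exact: WP.
  by case.
pose sub (V : {vspace dhomog N.+1 algC m}) :=
  forall q, q \in V -> mpoly_of_dhomog q \in Z.
pose P k := `[< exists2 V : {vspace dhomog N.+1 algC m}, sub V & \dim V = k >].
have exP : exists k, P k.
  exists 0%N; apply/asboolP; exists 0%VS; last exact: dimv0.
  by move=> q; rewrite memv0 => /eqP ->; rewrite raddf0 variety0.
have ubP k : P k -> (k <= \dim {:dhomog N.+1 algC m})%N.
  by move=> /asboolP[V _ <-]; rewrite dimvS ?subvf.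
case: (ex_maxnP exP ubP) => k /asboolP[V sV dV] kmax.
exists V => q; apply/idP/idP; first exact: sV.
move=> qZ.
have sW : sub (V + <[q]>)%VS.
  move=> w /memv_addP[v vV [u /vlineP[a ->] ->]].
  rewrite addrC linearP /= -mul_mpolyC.
  by apply: variety_lin => //; apply: sV.
have : (\dim (V + <[q]>) <= \dim V)%N.
  by rewrite dV; apply: kmax; apply/asboolP; exists (V + <[q]>)%VS.
move=> le; have /eqP -> : V == (V + <[q]>)%VS by rewrite eqEdim addvSl.
by apply: (subvP (addvSr V <[q]>%VS)); rewrite memv_line.
Qed.

Definition hilbert_fun (N : nat) (Z : variety N) (m : nat) : nat :=
  (\dim {:dhomog N.+1 algC m} - \dim (ideal_part Z m))%N.

Definition is_hilbert_poly (N : nat) (Z : variety N) (P : {poly rat}) : Prop :=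
  exists m0 : nat, forall m : nat, (m0 <= m)%N ->
    P.[m%:R] = (hilbert_fun Z m)%:R.

(* Dimension and degree are read off the Hilbert polynomial, which has leading
   term (d / r!) X^r for a variety of dimension r and degree d. *)
Definition has_dim (N : nat) (Z : variety N) (r : nat) : Prop :=
  exists2 P : {poly rat}, is_hilbert_poly Z P & size P = r.+1.

Definition has_degree (N : nat) (Z : variety N) (d : nat) : Prop :=
  exists2 P : {poly rat}, is_hilbert_poly Z P
    & lead_coef P * ((size P).-1)`!%:R = d%:R.

(* The rational point [x] = [x_0 : ... : x_N], as a line in Q^(N+1). *)
Definition proj_pt (N : nat) (x : 'rV[int]_N.+1) : {vspace 'rV[rat]_N.+1} :=
  <[map_mx intr x]>%VS.

Definition on_variety (N : nat) (Z : variety N) (x : 'rV[int]_N.+1) : Prop :=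
  forall p : {mpoly algC[N.+1]}, p \in Z -> p.@[fun i => (x ord0 i)%:~R] = 0.

Section CountingPoints.
Local Open Scope classical_set_scope.

(* The image under [proj_pt] identifies the representatives x and -x. *)
Definition count_variety (R : realType) (N : nat) (Z : variety N) (B : R)
    : nat :=
  #|` fset_set [set proj_pt x | x in [set x : 'rV[int]_N.+1 |
        [/\ on_variety Z x, primitive x & (height x)%:R <= B]]] |.

End CountingPoints.

(* Main.v *)
(* Let Z have dimension r = n - 1, coordinate ring A and Hilbert polynomial
   with leading term (d / r!) m^r.

   Projecting repeatedly from integral points of height at most d gives r + 1
   integral linear forms y over which A is finite; a point off Z of bounded
   height exists because Z lies on a form of degree at most d at each stage.
   Such a form is found by projecting, with no control on heights, to a
   hypersurface: r + 2 linear forms over which A is finite satisfy a single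
   irreducible relation F (an independent relation would make the growth of A
   at most m^(r-1)), and comparison of Hilbert functions gives deg F <= d.

   Let l_c be the linear form with indeterminate coefficients c, and chi the
   characteristic polynomial of multiplication by l_c on generators of A over
   the ring of the y's.  If s is minimal with chi^(s+1)(l_c) <> 0, differentiating
   chi^(s)(l_c) = 0 with respect to c_i gives chi^(s+1)(l_c) X_i as a polynomial
   in y and l_c.  Specialising c to small integers, the projection by (y, l_c)
   is birational onto its image, so its equation F has degree exactly d.

   If F is proportional to an integral form, the hypothesis applies to it.
   Otherwise the rational points lie on F = G = 0 for a second form G of degree d,
   and two further projections map them with finite fibres to primitive vectors
   of Z^r.  These inject into the zeros of X_0 X_2^(d-1) + X_1^d, an absolutely
   irreducible form to which the hypothesis applies; hence no lower bound on
   theta has to be proved. *)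

Require Import Defs.
From HB Require Import structures.
From mathcomp Require Import all_boot all_order all_algebra all_field.
From mathcomp Require Import finmap mpoly polyrcf.
From mathcomp Require Import boolp classical_sets cardinality reals exp.
From mathcomp Require Import zify ring lra.

Set Implicit Arguments.
Unset Strict Implicit.
Unset Printing Implicit Defensive.

Import Order.TTheory GRing.Theory Num.Theory.
Local Open Scope ring_scope.

(** * Polynomials and linear projections *)

Lemma mpoly_rmorph_ext (n : nat) (R S : nzRingType)
    (f g : {rmorphism {mpoly R[n]} -> S}) :
  (forall c, f c%:MP = g c%:MP) -> (forall i, f 'X_i = g 'X_i) -> f =1 g.
Proof.
move=> fgC fgX; apply: mpolyind => [|c m p _ _ IH]; first by rewrite !rmorph0.
rewrite !rmorphD /= {}IH; congr (_ + _).
rewrite -mul_mpolyC !rmorphM fgC mpolyXE_id !rmorph_prod; congr (_ * _).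
by apply: eq_bigr => i _; rewrite !rmorphXn fgX.
Qed.

Section LinearSubstitution.
Variables (R : comNzRingType).

Definition subst_tuple (m k : nat) (T : 'M[R]_(m, k)) :
  k.-tuple {mpoly R[m]} := [tuple \sum_j T j i *: 'X_j | i < k].

(* The substitution [X_i |-> sum_j T j i X_j], dual to [v |-> v *m T]. *)
Definition subst_mx (m k : nat) (T : 'M[R]_(m, k)) :
    {mpoly R[k]} -> {mpoly R[m]} := comp_mpoly (subst_tuple T).

HB.instance Definition _ (m k : nat) (T : 'M[R]_(m, k)) :=
  GRing.RMorphism.copy (subst_mx T) (comp_mpoly (subst_tuple T)).
HB.instance Definition _ (m k : nat) (T : 'M[R]_(m, k)) :=
  GRing.Linear.copy (subst_mx T) (comp_mpoly (subst_tuple T)).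

Lemma subst_mxC m k (T : 'M[R]_(m, k)) c : subst_mx T c%:MP = c%:MP.
Proof. exact: comp_mpolyC. Qed.

Lemma subst_mxX m k (T : 'M[R]_(m, k)) i :
  subst_mx T 'X_i = \sum_j T j i *: 'X_j.
Proof. by rewrite /subst_mx comp_mpolyXU -tnth_nth tnth_mktuple. Qed.

Lemma subst_mx_comp m k l (T : 'M[R]_(m, k)) (P : 'M[R]_(k, l)) q :
  subst_mx T (subst_mx P q) = subst_mx (T *m P) q.
Proof.
apply: (@mpoly_rmorph_ext _ _ _ (subst_mx T \o subst_mx P) (subst_mx (T *m P))) => [c|i] /=.
  by rewrite !subst_mxC.
rewrite !subst_mxX linear_sum /=.
under eq_bigr => j _ do rewrite linearZ /= subst_mxX scaler_sumr.
rewrite exchange_big /=; apply: eq_bigr => j _.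
rewrite mxE scaler_suml; apply: eq_bigr => u _.
by rewrite scalerA mulrC.
Qed.

Lemma subst_mx1 m (q : {mpoly R[m]}) : subst_mx 1%:M q = q.
Proof.
apply: (@mpoly_rmorph_ext _ _ _ (subst_mx 1%:M) idfun) => [c|i] /=.
  by rewrite subst_mxC.
rewrite subst_mxX (bigD1 i) //= mxE eqxx scale1r big1 ?addr0 // => j ji.
by rewrite mxE (negPf ji) scale0r.
Qed.

Lemma meval_subst_mx m k (T : 'M[R]_(m, k)) q (v : 'rV[R]_m) :
  (subst_mx T q).@[v ord0] = q.@[(v *m T) ord0].
Proof.
rewrite /subst_mx comp_mpoly_meval; apply: meval_eq => i.
rewrite tnth_mktuple mxE raddf_sum /=; apply: eq_bigr => j _.
by rewrite mevalZ mevalXU mulrC.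
Qed.

Lemma subst_mx_homog m k (T : 'M[R]_(m, k)) d q :
  q \is d.-homog -> subst_mx T q \is d.-homog.
Proof.
move=> /dhomogP hq; rewrite (mpolyE q) linear_sum big_seq rpred_sum // => u /hq <-.
rewrite linearZ rpredZ // mpolyXE_id rmorph_prod /= mdegE.
have H (I : Type) (r : seq I) (F : I -> {mpoly R[m]}) (e : I -> nat) :
    (forall i, F i \is (e i).-homog) ->
    \prod_(i <- r) F i \is (\sum_(i <- r) e i)%N.-homog.
  move=> hF; apply: (big_ind2 (fun p e => p \is e.-homog)) => //.
    exact: dhomog1.
  by move=> *; apply: dhomogM.
apply: H => i; rewrite rmorphXn -[X in _ \is X.-homog]mul1n.
apply: dhomogMn; rewrite /= subst_mxX rpred_sum // => j _.
by rewrite rpredZ // dhomogX; apply/eqP; exact: mdeg1.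
Qed.

End LinearSubstitution.

(** * Total degree in one distinguished variable and the others *)

Lemma msizeM_leq (n : nat) (R : nzRingType) (p q : {mpoly R[n]}) :
  (msize (p * q) <= (msize p + msize q).-1)%N.
Proof.
have [->|p0] := eqVneq p 0; first by rewrite mul0r msize0.
have [->|q0] := eqVneq q 0; first by rewrite mulr0 msize0.
have [->|pq0] := eqVneq (p * q) 0; first by rewrite msize0.
rewrite -!mlead_deg // addSn addnS /= ltnS.
by have /lemc_mdeg := mleadM_le p q; rewrite mdegD.
Qed.

(** As [msize] is the degree plus one, this bounds the total degree in ['X] and the other variables
    jointly by D. Truncated subtraction makes the coefficients of index above D vanish. *)
Definition tdeg_le (n : nat) (R : nzRingType) (D : nat)
    (f : {poly {mpoly R[n]}}) : Prop :=
  forall i, (msize f`_i <= D.+1 - i)%N.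

Section TotalDegree.
Variables (n : nat) (R : nzRingType).
Implicit Types f g : {poly {mpoly R[n]}}.

Lemma tdeg_leD D f g : tdeg_le D f -> tdeg_le D g -> tdeg_le D (f + g).
Proof.
move=> hf hg i; rewrite coefD (leq_trans (msizeD_le _ _)) //.
by rewrite geq_max hf hg.
Qed.

Lemma tdeg_le0 D : tdeg_le D (0 : {poly {mpoly R[n]}}).
Proof. by move=> i; rewrite coef0 msize0. Qed.

Lemma tdeg_leN D f : tdeg_le D f -> tdeg_le D (- f).
Proof. by move=> hf i; rewrite coefN msizeN. Qed.

Lemma tdeg_le_sum D (I : Type) (r : seq I) (P : pred I) (F : I -> {poly {mpoly R[n]}}) :
  (forall i, P i -> tdeg_le D (F i)) -> tdeg_le D (\sum_(i <- r | P i) F i).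
Proof.
by move=> h; apply: big_ind => //; [exact: tdeg_le0 | exact: tdeg_leD].
Qed.

Lemma tdeg_leM D E f g : tdeg_le D f -> tdeg_le E g -> tdeg_le (D + E) (f * g).
Proof.
move=> hf hg i; rewrite coefM (leq_trans (msize_sum _ _ _)) //.
apply/bigmax_leqP => j _.
have [->|fj0] := eqVneq f`_j 0; first by rewrite mul0r msize0.
have [->|gj0] := eqVneq g`_(i - j) 0; first by rewrite mulr0 msize0.
rewrite (leq_trans (msizeM_leq _ _)) //.
have := hf j; have := hg (i - j)%N; have := ltn_ord j.
move: fj0 gj0; rewrite -!msize_poly_eq0.
move: (msize f`_j) (msize g`_(i - j)) => x y; lia.
Qed.

Lemma tdeg_le1 : tdeg_le 0 (1 : {poly {mpoly R[n]}}).
Proof.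
by move=> [|i]; rewrite coef1 /= ?msize1 ?msize0.
Qed.

Lemma tdeg_le_exp D f m : tdeg_le D f -> tdeg_le (D * m) (f ^+ m).
Proof.
move=> hf; elim: m => [|m IH]; first by rewrite muln0 expr0; apply: tdeg_le1.
by rewrite exprS mulnS; apply: tdeg_leM.
Qed.

Lemma tdeg_le_size D f : tdeg_le D f -> (size f <= D.+1)%N.
Proof.
move=> hf; apply/leq_sizeP => j Dj; apply/eqP; rewrite -msize_poly_eq0.
by have := hf j; rewrite (eqP Dj) leqn0.
Qed.

Lemma tdeg_leX : tdeg_le 1 ('X : {poly {mpoly R[n]}}).
Proof. by move=> [|[|i]]; rewrite coefX ?msize0 ?msize1. Qed.

Lemma tdeg_leC D (p : {mpoly R[n]}) : (msize p <= D.+1)%N -> tdeg_le D p%:P.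
Proof. by move=> h [|i]; rewrite coefC ?msize0 ?subn0. Qed.

Lemma tdeg_le_mono D E f : (D <= E)%N -> tdeg_le D f -> tdeg_le E f.
Proof. by move=> DE hf i; apply: leq_trans (hf i) _; lia. Qed.

Lemma tdeg_le_derivn D f m : tdeg_le D f -> tdeg_le D (f^`(m)).
Proof.
move=> hf i; rewrite coef_derivn.
apply: (@leq_trans (msize f`_(m + i))); last by apply: leq_trans (hf _) _; lia.
by rewrite -mulr_natl -mpolyC_nat mul_mpolyC mmeasureZ_le.
Qed.

End TotalDegree.

Section Projection.
Variables (R : comNzRingType) (k : nat) (a : 'I_k -> R).

(* Projection from the point [1 : a_0 : ... : a_(k-1)] to the hyperplane X_0 = 0. *)
Definition proj_mx : 'M[R]_(k.+1, k) :=
  \matrix_(i, j) (if unlift ord0 i is Some i' then (i' == j)%:R else - a j).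

Definition to_poly_var (i : 'I_k.+1) : {poly {mpoly R[k]}} :=
  if unlift ord0 i is Some j then ('X_j)%:P + (a j)%:MP%:P * 'X else 'X.

(* With [of_poly], an isomorphism R[X_0, ..., X_k] ~ R[Y_0, ..., Y_(k-1)]['X]
   where Y_j = X_(j+1) - a_j X_0 and 'X = X_0. *)
Definition to_poly : {mpoly R[k.+1]} -> {poly {mpoly R[k]}} :=
  mmap (polyC \o @mpolyC k R) to_poly_var.

Definition of_poly : {poly {mpoly R[k]}} -> {mpoly R[k.+1]} :=
  horner_eval 'X_ord0 \o map_poly (subst_mx proj_mx).

HB.instance Definition _ := GRing.RMorphism.on to_poly.
HB.instance Definition _ := GRing.RMorphism.on of_poly.

Lemma to_polyC c : to_poly c%:MP = c%:MP%:P.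
Proof. exact: mmapC. Qed.

Lemma to_polyX i : to_poly 'X_i = to_poly_var i.
Proof. by rewrite /to_poly mmapX mmap1U. Qed.

Lemma of_polyC c : of_poly c%:P = subst_mx proj_mx c.
Proof. by rewrite /of_poly /= map_polyC /horner_eval hornerC. Qed.

Lemma of_polyX : of_poly 'X = 'X_ord0.
Proof. by rewrite /of_poly /= map_polyX /horner_eval hornerX. Qed.

Lemma subst_proj_mxX j :
  subst_mx proj_mx 'X_j = 'X_(lift ord0 j) - a j *: 'X_ord0.
Proof.
rewrite subst_mxX big_ord_recl mxE unlift_none addrC scaleNr; congr (_ - _).
rewrite (bigD1 j) //= mxE liftK eqxx scale1r big1 ?addr0 // => i ij.
by rewrite mxE liftK (negPf ij) scale0r.
Qed.

Lemma to_polyK : cancel to_poly of_poly.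
Proof.
apply: (@mpoly_rmorph_ext _ _ _ (of_poly \o to_poly) idfun) => [c|i] /=.
  by rewrite to_polyC of_polyC subst_mxC.
rewrite to_polyX /to_poly_var; case: unliftP => [j|] ->; last exact: of_polyX.
rewrite rmorphD rmorphM /= !of_polyC of_polyX subst_mxC subst_proj_mxX.
by rewrite mul_mpolyC subrK.
Qed.

Lemma of_polyK : cancel of_poly to_poly.
Proof.
have C (q : {mpoly R[k]}) : to_poly (of_poly q%:P) = q%:P.
  apply: (@mpoly_rmorph_ext _ _ _ (to_poly \o of_poly \o polyC) polyC) => [c|i] /=.
    by rewrite of_polyC subst_mxC to_polyC.
  rewrite of_polyC subst_proj_mxX rmorphB -mul_mpolyC rmorphM /=.
  by rewrite to_polyC !to_polyX /to_poly_var liftK unlift_none addrK.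
move=> q; rewrite -[q in LHS]coefK -[RHS]coefK !poly_def !rmorph_sum /=.
apply: eq_bigr => i _.
by rewrite -mul_polyC !rmorphM !rmorphXn /= C of_polyX to_polyX /to_poly_var unlift_none.
Qed.

Lemma to_poly_tdeg q D : (msize q <= D.+1)%N -> tdeg_le D (to_poly q).
Proof.
move=> hq; rewrite /to_poly /mmap big_seq; apply: tdeg_le_sum => m mq /=.
have hm : (mdeg m <= D)%N by rewrite -ltnS (leq_trans (msize_mdeg_lt mq)).
apply: (tdeg_le_mono hm); rewrite -[mdeg m]add0n; apply: tdeg_leM.
  by apply: tdeg_leC; rewrite msizeC leq_b1.
rewrite mdegE /mmap1.
apply: (big_ind2 (fun f e => tdeg_le e f)) => [|*|i _]; first exact: tdeg_le1.
  exact: tdeg_leM.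
rewrite -[X in tdeg_le X]mul1n; apply: tdeg_le_exp.
rewrite /to_poly_var; case: unlift => [j|]; last exact: tdeg_leX.
apply: tdeg_leD; first by apply: tdeg_leC; rewrite msizeX mdeg1.
rewrite -[X in tdeg_le X]add0n; apply: tdeg_leM; last exact: tdeg_leX.
by apply: tdeg_leC; rewrite msizeC leq_b1.
Qed.

Lemma to_poly_map_eval q (w : 'I_k -> R) t :
  (map_poly (meval w) (to_poly q)).[t] =
  q.@[fun i => if unlift ord0 i is Some j then w j + a j * t else t].
Proof.
apply: (@mpoly_rmorph_ext _ _ _ (horner_eval t \o map_poly (meval w) \o to_poly)
  (meval (fun i => if unlift ord0 i is Some j then w j + a j * t else t))) => [c|i] /=.
  by rewrite to_polyC map_polyC /horner_eval hornerC /= !mevalC.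
rewrite to_polyX mevalXU /to_poly_var /horner_eval; case: unlift => [j|].
  rewrite rmorphD rmorphM /= !map_polyC map_polyX /= mevalXU mevalC.
  by rewrite hornerD hornerM !hornerC hornerX.
by rewrite map_polyX hornerX.
Qed.

(** This is what makes a projection finite: a form not vanishing at the centre becomes, up to a
    nonzero constant, monic in X_0. The pair of conditions [top] is multiplicative, so it passes
    from variables to monomials. *)
Lemma to_poly_coef_top q e : q \is e.-homog ->
  (to_poly q)`_e = (q.@[fun i => if unlift ord0 i is Some j then a j else 1])%:MP.
Proof.
set v := fun i => _.
pose top e (f : {poly {mpoly R[k]}}) c := tdeg_le e f /\ f`_e = c%:MP.
have topM e1 e2 f1 f2 c1 c2 : top e1 f1 c1 -> top e2 f2 c2 ->
    top (e1 + e2)%N (f1 * f2) (c1 * c2).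
  move=> [h1 t1] [h2 t2]; split; first exact: tdeg_leM.
  rewrite coefM (bigD1 (inord e1)) //= inordK ?ltnS ?leq_addr // addKn t1 t2 -mpolyCM.
  rewrite big1 ?addr0 // => i ine.
  have [lt|gt|eq] := ltngtP i e1; last by case/eqP: ine; apply: val_inj; rewrite /= inordK // ltnS leq_addr.
    by rewrite [f2`__]nth_default ?mulr0 // (leq_trans (tdeg_le_size h2)) //; lia.
  by rewrite [f1`__]nth_default ?mul0r // (leq_trans (tdeg_le_size h1)).
have topv i : top 1%N (to_poly_var i) (v i).
  rewrite /to_poly_var /v; case: unlift => [j|]; last first.
    by split; [exact: tdeg_leX | rewrite coefX].
  split; last by rewrite coefD coefC add0r coefCM coefX mulr1.
  apply: tdeg_leD; first by apply: tdeg_leC; rewrite msizeX mdeg1.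
  rewrite -[X in tdeg_le X]add0n; apply: tdeg_leM; last exact: tdeg_leX.
  by apply: tdeg_leC; rewrite msizeC leq_b1.
have top1 : top 0%N 1 1 by split; [exact: tdeg_le1 | rewrite coef1 mpolyC1].
move=> /dhomogP hq; rewrite /to_poly /mmap mevalE coef_sum rmorph_sum /=.
rewrite !big_seq; apply: eq_bigr => m /hq hm.
rewrite coefCM rmorphM /=; congr (_ * _).
suff [_] : top e (mmap1 to_poly_var m) (\prod_i v i ^+ m i) by [].
rewrite -hm -[X in top X]/(mdeg m) mdegE /mmap1.
apply: (big_ind3 top) => // [*|i _]; first exact: topM.
elim: (m i) => [|j IH]; first by rewrite !expr0.
by rewrite !exprS -add1n; apply: topM.
Qed.

Lemma mul_proj_mx (v : 'rV[R]_k.+1) j :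
  (v *m proj_mx) ord0 j = v ord0 (lift ord0 j) - a j * v ord0 ord0.
Proof.
rewrite mxE big_ord_recl mxE unlift_none addrC mulrN mulrC; congr (_ - _).
rewrite (bigD1 j) //= mxE liftK eqxx mulr1 big1 ?addr0 // => i ij.
by rewrite mxE liftK (negPf ij) mulr0.
Qed.

Lemma proj_mx_inj (v v' : 'rV[R]_k.+1) :
  v *m proj_mx = v' *m proj_mx -> v ord0 ord0 = v' ord0 ord0 -> v = v'.
Proof.
move=> e e0; apply/rowP => i; case: (unliftP ord0 i) => [j|] ->; last by [].
have := congr1 (fun w : 'rV_k => w ord0 j) e.
by rewrite !mul_proj_mx e0 => /addIr.
Qed.

Lemma subst_proj_mx_inj : injective (subst_mx proj_mx).
Proof.
move=> q q' e; apply/polyC_inj/(can_inj of_polyK).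
by rewrite !of_polyC.
Qed.

(** The polynomial on the left is the restriction of q to the line through v in the direction of the
    centre, parametrised by X_0. *)
Lemma proj_mx_fibre q (v : 'rV[R]_k.+1) :
  root (map_poly (meval ((v *m proj_mx) ord0)) (to_poly q)) (v ord0 ord0) =
  (q.@[v ord0] == 0).
Proof.
rewrite /root to_poly_map_eval; congr (_ == _); apply: meval_eq => i.
case: unliftP => [j|] -> //; by rewrite mul_proj_mx subrK.
Qed.

End Projection.

Definition char_zero (R : nzRingType) : Prop :=
  forall n : nat, n%:R = 0 :> R -> n = 0%N.

Lemma char_zero_inj (R : nzRingType) : char_zero R -> injective (fun n : nat => n%:R : R).
Proof.
move=> R0 x y; wlog xy : x y / (x <= y)%N => [hw e|].
  by case: (leqP x y) => [/hw->//|/ltnW/hw->].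
move=> /= /eqP; rewrite eq_sym -subr_eq0 -natrB // => /eqP/R0; lia.
Qed.

Lemma poly_nonroot (R : idomainType) (D : nat) (p : {poly R}) :
  char_zero R -> p != 0 -> (size p <= D.+1)%N ->
  exists2 c : nat, (c <= D)%N & p.[c%:R] != 0.
Proof.
move=> R0 p0 sp; pose s := [seq (i%:R : R) | i <- iota 0 D.+1].
have us : uniq s by rewrite map_inj_uniq ?iota_uniq //; apply: char_zero_inj.
have /allPn[y /mapP[c]] : ~~ all (root p) s.
  apply/negP => /(max_poly_roots p0)/(_ us).
  by rewrite size_map size_iota ltnNge sp.
by rewrite mem_iota => /andP[_ cD] -> nr; exists c.
Qed.

(** Induction on the number of variables: first keep the leading coefficient in X_0 nonzero, then
    choose X_0 among D + 1 integers. All the height bounds below come from here. *)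
Lemma mpoly_nonzero_eval (R : idomainType) (n D : nat) (p : {mpoly R[n]}) :
  char_zero R -> p != 0 -> (msize p <= D.+1)%N ->
  exists2 c : 'I_n -> nat, (forall i, (c i <= D)%N) & p.@[fun i => (c i)%:R] != 0.
Proof.
move=> R0; elim: n p => [|n IH] p p0 sp.
  exists (fun=> 0%N) => //; move: p0.
  by rewrite -(mpolyKC p) mpolyC_eq0 mevalC.
pose f := to_poly (fun=> 0 : R) p.
have f0 : f != 0.
  by apply: contra_neq p0 => f0; rewrite -(to_polyK (fun=> 0) p) -/f f0 rmorph0.
have hf : tdeg_le D f by apply: to_poly_tdeg.
have [|c cD hc] := IH (lead_coef f) _ (leq_trans (hf _) (leq_subr _ _)).
  by rewrite lead_coef_eq0.
pose g := map_poly (meval (fun i => (c i)%:R)) f.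
have g0 : g != 0.
  apply/eqP => /(congr1 (fun h : {poly R} => h`_(size f).-1)).
  by rewrite coef_map coef0; apply/eqP.
have [|b bD hb] := poly_nonroot R0 g0 (_ : (size g <= D.+1)%N).
  by apply: leq_trans (size_poly _ _) _; apply: tdeg_le_size.
exists (fun i => if unlift ord0 i is Some j then c j else b).
  by move=> i; case: unlift.
move: hb; rewrite to_poly_map_eval; congr (_ != _); apply: meval_eq => i.
by case: unlift => // j; rewrite mul0r addr0.
Qed.

Lemma meval_homog (R : comNzRingType) (n d : nat) (p : {mpoly R[n]}) t v :
  p \is d.-homog -> p.@[fun i => t * v i] = t ^+ d * p.@[v].
Proof.
move=> /dhomogP hp; rewrite !mevalE mulr_sumr !big_seq.
apply: eq_bigr => m /hp <-; rewrite mulrCA; congr (_ * _).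
rewrite -[X in _ ^+ X]/(mdeg m) mdegE -prodrXr -big_split; apply: eq_bigr => i _.
by rewrite exprMn.
Qed.

Section ProjectionStep.
Variables (K : fieldType) (k e : nat) (G : {mpoly K[k.+1]}).
Hypothesis (homG : G \is e.-homog).

Definition proj_centre (a : 'I_k -> K) (i : 'I_k.+1) : K :=
  if unlift ord0 i is Some j then a j else 1.

Lemma proj_centre_exists : char_zero K -> G != 0 ->
  exists2 a : 'I_k -> nat, (forall i, (a i <= e)%N)
    & G.@[proj_centre (fun i => (a i)%:R)] != 0.
Proof.
move=> K0 G0.
pose h (i : 'I_k.+1) : {mpoly K[k]} := if unlift ord0 i is Some j then 'X_j else 1.
pose H := mmap (@mpolyC k K) h G.
have evH (a : 'I_k -> K) : H.@[a] = G.@[proj_centre a].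
  apply: (@mpoly_rmorph_ext _ _ _ (meval a \o mmap (@mpolyC k K) h) (meval (proj_centre a))) => [c|i] /=.
    by rewrite mmapC !mevalC.
  rewrite mmapX mmap1U mevalXU /h /proj_centre; case: unlift => [j|]; first by rewrite mevalXU.
  by rewrite meval1.
have sH : (msize H <= e.+1)%N.
  rewrite /H /mmap (leq_trans (msize_sum _ _ _)) //.
  apply/bigmax_leqP_seq => m /(dhomogP _ _ _ homG) hm _.
  rewrite mul_mpolyC (leq_trans (msizeZ_le _ _)) // -hm -[X in (_ <= X.+1)%N]/(mdeg m) mdegE /mmap1.
  apply: (big_ind2 (fun p d => msize p <= d.+1)%N) => [|p d q d' hp hq|i _].
  - by rewrite msize1.
  - have [->|p0] := eqVneq p 0; first by rewrite mul0r msize0.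
    have [->|q0] := eqVneq q 0; first by rewrite mulr0 msize0.
    rewrite msizeM //; move: (msize p) (msize q) hp hq => x y; lia.
  rewrite /h; case: unlift => [j|]; last by rewrite expr1n msize1.
  by rewrite mpolyXn msizeX mdegMn mdeg1 mul1n.
suff H0 : H != 0.
  have [a aD ha] := mpoly_nonzero_eval K0 H0 sH.
  by exists a => //; rewrite -evH.
(* H is G dehomogenised at X_0 = 1. If it vanished, G would vanish wherever X_0 is nonzero, but X_0
   G takes a nonzero value at some integral point. *)
apply: contra_neq G0 => H0; apply/eqP/contraT => G0.
have GX0 : 'X_ord0 * G != 0.
  by rewrite mulf_eq0 negb_or G0 -msize_poly_eq0 msizeX.
have [v _] := mpoly_nonzero_eval K0 GX0 (leqnSn _).
set w := fun i => _; rewrite mevalM mevalXU mulf_eq0 negb_or => /andP[w0].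
have -> : G.@[w] = w ord0 ^+ e * G.@[proj_centre (fun j => w (lift ord0 j) / w ord0)].
  rewrite -(meval_homog _ _ homG); apply: meval_eq => i; rewrite /proj_centre.
  by case: unliftP => [j|] ->; rewrite ?mulr1 // mulrCA divff ?mulr1.
by rewrite -evH H0 meval0 mulr0 eqxx.
Qed.

Variable (a : 'I_k -> K).
Hypothesis (Ga : G.@[proj_centre a] != 0).

(** Euclidean division by G in X_0, possible because its leading coefficient is the nonzero value of
    G at the centre. Modulo G, the powers of X_0 below e thus generate all polynomials over those in
    the projected coordinates. *)
Lemma proj_division (q : {mpoly K[k.+1]}) :
  exists (r : 'I_e -> {mpoly K[k]}) u,
    q = \sum_s subst_mx (proj_mx a) (r s) * 'X_ord0 ^+ s + u * G.
Proof.
pose g := to_poly a G.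
have ge : g`_e = (G.@[proj_centre a])%:MP by apply: to_poly_coef_top.
have tg : tdeg_le e g.
  by apply: to_poly_tdeg; move: (dhomogP _ _ _ homG) => h; apply/bigmax_leqP_seq => m /h ->.
have ge0 : g`_e != 0 by rewrite ge mpolyC_eq0.
have sg : size g = e.+1.
  apply/eqP; rewrite eqn_leq (tdeg_le_size tg) ltnNge.
  by apply: contra ge0 => /leq_sizeP->.
have lg : lead_coef g \is a GRing.unit.
  rewrite lead_coefE sg ge; apply/andP; split.
    by apply/eqP; rewrite mcoeffC eqxx mulr1.
  by rewrite mcoeffC eqxx mulr1 unitfE.
pose f := to_poly a q.
exists (fun s : 'I_e => (f %% g)`_s), (of_poly a (f %/ g)).
rewrite -[q](to_polyK a) -/f {1}(Pdiv.IdomainUnit.divp_eq lg f).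
rewrite rmorphD rmorphM /= to_polyK addrC; congr (_ + _).
set r := f %% g.
have sr : (size r <= e)%N by rewrite -ltnS -sg Pdiv.Idomain.ltn_modpN0 // -size_poly_eq0 sg.
rewrite -[r in LHS]coefK poly_def rmorph_sum /= (big_ord_widen _ (fun s => of_poly a (r`_s *: 'X^s)) sr).
rewrite big_mkcond /=; apply: eq_bigr => s _.
rewrite -mul_polyC rmorphM rmorphXn /= of_polyC of_polyX.
by case: ltnP => // hs; rewrite nth_default // rmorph0 mul0r.
Qed.

Lemma proj_fibre (w : 'rV[K]_k) :
  exists g : {poly K}, [/\ g != 0, (size g <= e.+1)%N & forall v : 'rV[K]_k.+1,
    v *m proj_mx a = w -> G.@[v ord0] = 0 -> root g (v ord0 ord0)].
Proof.
pose f := to_poly a G.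
have tf : tdeg_le e f.
  by apply: to_poly_tdeg; move: (dhomogP _ _ _ homG) => h; apply/bigmax_leqP_seq => m /h ->.
exists (map_poly (meval (w ord0)) f); split.
- apply: contra_neq Ga => /(congr1 (fun h : {poly K} => h`_e)).
  by rewrite coef_map coef0 /= to_poly_coef_top // mevalC.
- by apply: leq_trans (size_poly _ _) _; apply: tdeg_le_size.
by move=> v <- /eqP; rewrite proj_mx_fibre.
Qed.

End ProjectionStep.

(** * Gauss's lemma *)

Definition divides (R : comNzRingType) (p a : R) : Prop := exists c, a = c * p.

Definition prime_elt (R : idomainType) (p : R) : Prop :=
  [/\ p != 0, p \isn't a GRing.unit
    & forall a b : R, divides p (a * b) -> divides p a \/ divides p b].

Definition irreducible_prime (R : idomainType) : Prop :=
  forall p : R, irreducible_elt p -> prime_elt p.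

(** A measure that drops on proper divisors, in the role of the chain condition in a factorial
    ring. *)
Definition factor_norm (R : idomainType) (N : R -> nat) : Prop :=
  forall a b, a \isn't a GRing.unit -> a != 0 -> b != 0 -> (N b < N (a * b)%R)%N.

Lemma divides_sum (R : comNzRingType) (p : R) (I : finType) (P : pred I) (F : I -> R) :
  (forall i, P i -> divides p (F i)) -> divides p (\sum_(i | P i) F i).
Proof.
move=> h; apply: (big_ind (divides p)) => //; first by exists 0; rewrite mul0r.
by move=> x y [c ->] [c' ->]; exists (c + c'); rewrite mulrDl.
Qed.

Lemma divides_polyC (R : comNzRingType) (p : R) (f : {poly R}) :
  divides p%:P f <-> forall i, divides p f`_i.
Proof.
split=> [[g ->] i|/choice[c hc]]; first by exists g`_i; rewrite coefMC.
exists (\poly_(i < size f) c i); apply/polyP => i.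
rewrite coefMC coef_poly; case: ltnP => // hi.
by rewrite mul0r nth_default.
Qed.

(** Take the first coefficients, of index i and j, of f and g not divisible by p: modulo p, the
    coefficient of index i + j of the product is their product. *)
Lemma prime_elt_polyC (R : idomainType) (p : R) : prime_elt p -> prime_elt p%:P.
Proof.
move=> [p0 pU pP]; split.
- by rewrite polyC_eq0.
- by rewrite poly_unitE coefC eqxx (negPf pU) andbF.
move=> f g /divides_polyC fg.
case: (pselect (divides p%:P f)) => [|/divides_polyC/existsNP nf]; first by left.
case: (pselect (divides p%:P g)) => [|/divides_polyC/existsNP ng]; first by right.
have first_coef h : (exists i, ~ divides p h`_i) ->
    exists2 i, ~ divides p h`_i & forall j, (j < i)%N -> divides p h`_j.
  move=> [i hi].
  have ex : exists i, `[< ~ divides p h`_i >] by exists i; apply/asboolP.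
  case: (ex_minnP ex) => j /asboolP hj jmin; exists j => // u uj.
  by apply: contrapT => hu; have := jmin u (asboolT hu); rewrite leqNgt uj.
have [i fi fmin] := first_coef _ nf; have [j gj gmin] := first_coef _ ng.
have ij : (i < (i + j).+1)%N by rewrite ltnS leq_addr.
have [c] := fg (i + j)%N.
rewrite coefM (bigD1 (Ordinal ij)) //= addKn => e.
have [c' hc'] : divides p (\sum_(u < (i + j).+1 | u != Ordinal ij) f`_u * g`_(i + j - u)).
  apply: divides_sum => u ui.
  case: (ltngtP u i) => [/fmin[b ->]|iu|eq].
  - by exists (b * g`_(i + j - u)); rewrite mulrAC.
  - have [|b ->] := gmin (i + j - u)%N; first by have := ltn_ord u; lia.
    by exists (f`_u * b); rewrite mulrA.
  - by case/eqP: ui; apply: val_inj.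
have : divides p (f`_i * g`_j).
  by exists (c - c'); rewrite mulrBl -e hc' addrK.
by case/pP.
Qed.

Section GaussLemma.
Variables (R : idomainType) (N : R -> nat).
Hypotheses (normN : factor_norm N) (irrP : irreducible_prime R).
Implicit Types (f g h : {poly R}) (c : R).

Lemma factor_ind (P : R -> Prop) :
  (forall c, c \is a GRing.unit -> P c) ->
  (forall c, prime_elt c -> P c) ->
  (forall a b, a != 0 -> b != 0 -> P a -> P b -> P (a * b)) ->
  forall c, c != 0 -> P c.
Proof.
move=> PU Pp PM c; have [m] := ubnP (N c); elim: m c => // m IH c cm c0.
case: (boolP (c \is a GRing.unit)) => [/PU //|cU].
case: (pselect (irreducible_elt c)) => [/irrP/Pp //|nirr].
have [a [b [e aU bU]]] : exists a b, [/\ c = a * b, a \isn't a GRing.unit & b \isn't a GRing.unit].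
  apply: contrapT => nex; apply: nirr; split=> // a b e.
  case: (boolP (a \is a GRing.unit)) => [|aU]; first by left.
  case: (boolP (b \is a GRing.unit)) => [|bU]; first by right.
  by case: nex; exists a, b.
move: c0 cm; rewrite e mulf_eq0 negb_or => /andP[a0 b0] cm.
apply: PM => //; apply: IH => //; rewrite -ltnS; apply: leq_trans cm; rewrite ltnS.
  by rewrite mulrC normN.
by rewrite normN.
Qed.

Definition primitive_poly f : Prop := forall p, prime_elt p -> ~ divides p%:P f.

(** Removes the denominator c one prime at a time: a prime factor of c divides g * f but not the
    primitive f, so it divides g and cancels. *)
Lemma divides_clear f : primitive_poly f ->
  forall c, c != 0 -> forall g h, c *: h = g * f -> divides f h.
Proof.
move=> fprim; apply: factor_ind => [c cU g h e|p pP g h e|a b a0 b0 IHa IHb g h].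
- exists (c^-1 *: g); rewrite -scalerAl -e scalerA mulVr ?scale1r //.
- have [p0 _ _] := pP; have [pp0 _ ppP] := prime_elt_polyC pP.
  have [|[g' eg]|//] := ppP g f; first by exists h; rewrite -e -mul_polyC mulrC.
    exists g'; apply: (mulfI pp0); rewrite mul_polyC e eg; ring.
  by move/(fprim _ pP).
- rewrite -scalerA => /IHa[g' /IHb]; exact.
Qed.

(** Each prime factor of c divides g or h and is cancelled there, which leaves the degrees
    unchanged. A factorisation over the fraction field thus descends to R. *)
Lemma split_clear c : c != 0 -> forall f g h, c *: f = g * h ->
  exists g' h', [/\ f = g' * h', size g' = size g & size h' = size h].
Proof.
apply: (@factor_ind (fun c => forall f g h, c *: f = g * h ->
  exists g' h', [/\ f = g' * h', size g' = size g & size h' = size h]))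
    => [{}c cU f g h e|p pP f g h e|a b a0 b0 IHa IHb f g h].
- have c0 : c^-1 != 0 by rewrite invr_eq0; apply: contraTneq cU => ->; rewrite unitr0.
  exists (c^-1 *: g), h; split; rewrite ?size_scale //.
  by rewrite -scalerAl -e scalerA mulVr ?scale1r.
- have [p0 _ _] := pP; have [pp0 _ ppP] := prime_elt_polyC pP.
  have [|[g' eg]|[h' eh]] := ppP g h; first by exists f; rewrite -e -mul_polyC mulrC.
    exists g', h; split=> //.
      by apply: (mulfI pp0); rewrite mul_polyC e eg; ring.
    by rewrite eg mulrC mul_polyC size_scale.
  exists g, h'; split=> //.
    by apply: (mulfI pp0); rewrite mul_polyC e eh; ring.
  by rewrite eh mulrC mul_polyC size_scale.
- rewrite -scalerA => /IHa[g1 [h1 [e1 s1 s2]]].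
  have [g' [h' [e' s1' s2']]] := IHb _ _ _ e1.
  by exists g', h'; split; rewrite ?s1' ?s2'.
Qed.

(** The relation [%|] over a domain is divisibility up to a nonzero scalar, that is, over the
    fraction field, where gcds exist. Since a nonconstant irreducible f is primitive,
    [divides_clear] brings the conclusion back to R. *)
Lemma poly_irreducible_prime : irreducible_prime {poly R}.
Proof.
move=> f [f0 fU fI].
have sub g h : f = g * h -> size g = 1%N \/ size h = 1%N.
  by case/fI; rewrite poly_unitE => /andP[/eqP-> _]; [left|right].
have [sf|sf] := leqP (size f) 1.
  have ef : f = (f`_0)%:P by apply: size1_polyC.
  rewrite ef; apply: prime_elt_polyC; apply: irrP; split.
  - by rewrite -polyC_eq0 -ef.
  - by move: fU; rewrite ef poly_unitE coefC eqxx size_polyC -polyC_eq0 -ef f0.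
  move=> a b e; have : f = a%:P * b%:P by rewrite -polyCM -e.
  by case/fI; rewrite poly_unitE coefC eqxx => /andP[_]; [left|right].
have fprim : primitive_poly f.
  move=> p [p0 pU _] [g e].
  have [|] := fI _ _ e; last by rewrite poly_unitE coefC eqxx (negPf pU) andbF.
  rewrite poly_unitE => /andP[/eqP sg _].
  by move: sf; rewrite e mulrC mul_polyC size_scale // sg.
split=> // g h [u e].
have clear x : f %| x -> divides f x.
  by move=> /Pdiv.Idomain.dvdpP[[c q] /= c0 e']; apply: (divides_clear fprim c0 e').
have fgh : f %| g * h by rewrite e Pdiv.Idomain.dvdp_mull.
have [cop|ncop] := boolP (coprimep f g).
  by right; apply: clear; rewrite -(Pdiv.Idomain.Gauss_dvdpr h cop).
(* The gcd q of f and g is not constant. By [split_clear] and irreducibility the cofactor of q in f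
   is constant, so f divides q and hence g. *)
left; apply: clear; apply: Pdiv.Idomain.dvdp_trans (Pdiv.Idomain.dvdp_gcdr f g).
have := Pdiv.Idomain.dvdp_gcdl f g.
have := ncop; rewrite Pdiv.Idomain.coprimep_def; set q := gcdp f g => sq qf.
have /Pdiv.Idomain.dvdpP[[c w] /= c0 ew] := qf.
have [w' [q' [ef sw' sq']]] := split_clear c0 ew.
have [sw1|] := sub _ _ ef; last by rewrite sq' => e1; rewrite e1 eqxx in sq.
have : size q = size f.
  rewrite ef [RHS]size_mul ?sq' ?sw1 //.
    by rewrite -size_poly_eq0 sw1.
  by apply: contra_neq f0 => q0; rewrite ef q0 mulr0.
by move=> /eqP; rewrite (Pdiv.Idomain.dvdp_size_eqp qf) => /andP[].
Qed.

End GaussLemma.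

Lemma mpoly_unit_msize (K : fieldType) n (p : {mpoly K[n]}) :
  p \is a GRing.unit = (msize p == 1%N).
Proof.
apply/andP/msize_poly1P => [[/eqP e u]|[c c0 ->]].
  by exists p@_0 => //; move: u; rewrite unitfE.
by rewrite mcoeffC eqxx mulr1 unitfE.
Qed.

Lemma factor_norm_msize (K : fieldType) n :
  factor_norm (fun p : {mpoly K[n]} => msize p).
Proof.
move=> a b; rewrite mpoly_unit_msize => aU a0 b0.
rewrite msizeM //; move: aU a0 b0; rewrite -!msize_poly_eq0.
move: (msize a) (msize b) => x y; lia.
Qed.

Lemma irreducible_iso (R S : idomainType) (f : {rmorphism R -> S}) (g : {rmorphism S -> R}) :
  cancel f g -> cancel g f -> irreducible_prime S -> irreducible_prime R.
Proof.
move=> fK gK irrS p [p0 pU pI].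
have unitE x : (f x \is a GRing.unit) = (x \is a GRing.unit).
  by apply/idP/idP => [/(rmorph_unit g)|/(rmorph_unit f)]; rewrite ?fK.
have [|fp0 fpU fpP] := irrS (f p).
  split; rewrite ?unitE //.
    by apply: contra_neq p0 => e; rewrite -(fK p) e rmorph0.
  move=> a b e; rewrite -(gK a) -(gK b) !unitE; apply: pI.
  by rewrite -(fK p) e rmorphM.
have divE x : divides p x <-> divides (f p) (f x).
  split=> [[c ->]|[c e]]; first by exists (f c); rewrite rmorphM.
  by exists (g c); rewrite -(fK x) e rmorphM fK.
by split=> // a b /divE; rewrite rmorphM => /fpP[] /divE; [left|right].
Qed.

(** The isomorphism [to_poly] with centre 0 singles out one variable, and Gauss's lemma gives the
    induction step. Without variables every nonzero element is a unit. *)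
Lemma mpoly_irreducible_prime (K : fieldType) n : irreducible_prime {mpoly K[n]}.
Proof.
elim: n => [p [p0 pU _]|n IH].
  case/negP: pU; rewrite mpoly_unit_msize -(mpolyKC p) msizeC.
  by rewrite -(mpolyC_eq0 0) mpolyKC p0.
pose a := (fun=> 0) : 'I_n -> K.
pose f : {rmorphism {mpoly K[n.+1]} -> {poly {mpoly K[n]}}} := to_poly a.
pose g : {rmorphism {poly {mpoly K[n]}} -> {mpoly K[n.+1]}} := of_poly a.
have fK : cancel f g := to_polyK a.
have gK : cancel g f := of_polyK a.
have h := @irreducible_iso {mpoly K[n.+1]} {poly {mpoly K[n]}} f g fK gK.
exact: h (poly_irreducible_prime (@factor_norm_msize K n) IH).
Qed.

(** * Hilbert functions *)

Section PolyGrowth.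
Implicit Types (P Q : {poly rat}).

(** Multiplication by a form of degree c shifts degrees by c, which turns a Hilbert polynomial P(m)
    into P(m - c). *)
Definition pshift (c : rat) P : {poly rat} := P \Po ('X - c%:P).

Lemma horner_pshift c P x : (pshift c P).[x] = P.[x - c].
Proof. by rewrite horner_comp !hornerE. Qed.

Lemma size_pshift c P : size (pshift c P) = size P.
Proof. by rewrite size_comp_poly2 // size_XsubC. Qed.

Lemma pshiftXn (c : rat) i :
  (size ('X^i - pshift c 'X^i)%R <= i)%N /\
  ('X^(i.+1) - pshift c 'X^(i.+1))`_i = i.+1%:R * c.
Proof.
suff H j : exists2 r : {poly rat}, (size r <= j)%N
    & ('X - c%:P) ^+ j.+1 = 'X^(j.+1) - (j.+1%:R * c) *: 'X^j + r.
  split; last first.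
    have [r sr e] := H i; rewrite /pshift comp_Xn_poly e opprD addrA opprB addrCA subrr addr0.
    by rewrite coefB coefZ coefXn eqxx mulr1 nth_default ?subr0.
  case: i => [|i]; first by rewrite /pshift comp_Xn_poly !expr0 subrr size_poly0.
  have [r sr e] := H i; rewrite /pshift comp_Xn_poly e opprD addrA opprB addrCA subrr addr0.
  rewrite (leq_trans (size_polyD _ _)) // geq_max size_polyN (leqW sr) andbT.
  by rewrite (leq_trans (size_scale_leq _ _)) // size_polyXn.
elim: j => [|j [r sr e]].
  by exists 0; rewrite ?size_poly0 // !expr1 expr0 addr0 mul1r -mul_polyC mulr1.
exists (r * 'X + (j.+1%:R * c ^+ 2) *: 'X^j - c *: r).
  rewrite (leq_trans (size_polyD _ _)) // geq_max size_polyN.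
  rewrite (leq_trans (size_scale_leq _ _) (leqW sr)) andbT.
  rewrite (leq_trans (size_polyD _ _)) // geq_max.
  rewrite (leq_trans (size_polyMleq _ _)) ?size_polyX ?addn2 //=.
  by rewrite (leq_trans (size_scale_leq _ _)) // size_polyXn.
rewrite exprSr e -!mul_polyC !(exprS 'X) !polyCM ?polyC_exp /=.
rewrite -[j.+2%:R]natr1 polyCD polyC1; ring.
Qed.

Lemma poly_diff_pshiftE c P s : (size P <= s)%N ->
  P - pshift c P = \sum_(i < s) P`_i *: ('X^i - pshift c 'X^i).
Proof.
move=> sP; have eP : P = \sum_(i < s) P`_i *: 'X^i.
  rewrite -[LHS]coefK poly_def (big_ord_widen _ (fun i => P`_i *: 'X^i) sP) big_mkcond /=.
  by apply: eq_bigr => i _; case: ltnP => // hi; rewrite nth_default ?scale0r.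
rewrite {1 2}eP /pshift raddf_sum -sumrB /=; apply: eq_bigr => i _.
by rewrite comp_polyZ scalerBr.
Qed.

(** Only the top term counts: X^(s+1) - (X - c)^(s+1) begins with (s + 1) c X^s, and lower powers of
    X contribute lower degrees. *)
Lemma pshift_diff c P s : (size P <= s.+2)%N ->
  (size (P - pshift c P)%R <= s.+1)%N /\ (P - pshift c P)`_s = s.+1%:R * c * P`_s.+1.
Proof.
move=> sP; rewrite (poly_diff_pshiftE c sP); split.
  rewrite (leq_trans (size_sum _ _ _)) //; apply/bigmax_leqP => i _.
  apply: leq_trans (size_scale_leq _ _) (leq_trans (pshiftXn c i).1 _).
  by rewrite -ltnS ltn_ord.
rewrite big_ord_recr coefD coefZ (pshiftXn _ _).2 mulrC coef_sum big1 ?add0r // => i _.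
rewrite coefZ [X in _ * X]nth_default ?mulr0 //; apply: leq_trans (pshiftXn c (widen_ord (leqnSn s.+1) i)).1 _.
exact: (ltn_ord i).
Qed.

Lemma coef_pshift_top c P s : (size P <= s.+1)%N -> (pshift c P)`_s = P`_s.
Proof.
move=> sP; apply/esym/eqP; rewrite -subr_eq0 -coefB (poly_diff_pshiftE c sP).
rewrite coef_sum big1 // => i _.
by rewrite coefZ [X in _ * X]nth_default ?mulr0 //; apply: leq_trans (pshiftXn c i).1 _; rewrite -ltnS ltn_ord.
Qed.

(** A positive coefficient of X^s in P - Q would be its leading one, making P - Q eventually
    positive. Either polynomial may have degree below s, so the lemma also compares orders of
    growth. *)
Lemma poly_le_coef P Q s m0 : (size P <= s.+1)%N -> (size Q <= s.+1)%N ->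
  (forall m : nat, (m0 <= m)%N -> P.[m%:R] <= Q.[m%:R]) -> P`_s <= Q`_s.
Proof.
move=> sP sQ le; rewrite leNgt -subr_gt0 -coefB; apply/negP => lt.
have lc : lead_coef (P - Q) = (P - Q)`_s.
  rewrite lead_coefE; congr (_`__); apply/eqP; rewrite eqn_leq -ltnS.
  have s0 : (s < size (P - Q)%R)%N.
    by rewrite ltnNge; apply: contraTN lt => /leq_sizeP->; rewrite ?ltxx.
  rewrite (ltn_predK s0) (leq_trans (size_polyD _ _)) ?geq_max ?size_polyN ?sP //=.
  by rewrite -ltnS (ltn_predK s0).
rewrite -lc in lt; have [x hx] := poly_pinfty_gt_lc lt.
pose m := maxn m0 (Num.bound `|x|).
have xm : x <= m%:R.
  by apply: le_trans (ler_norm x) (le_trans (ltW (archi_boundP (normr_ge0 x))) _); rewrite ler_nat leq_maxr.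
have := hx _ xm; rewrite hornerD hornerN leNgt => /negP; apply.
by apply: le_lt_trans lt; rewrite subr_le0; apply: le; apply: leq_maxl.
Qed.

(** The Hilbert polynomial of projective s-space. *)
Definition binomial_poly (s : nat) : {poly rat} :=
  (s`!%:R^-1) *: \prod_(i < s) ('X + i.+1%:R%:P).

Lemma horner_binomial_poly s m : (binomial_poly s).[m%:R] = 'C(m + s, s)%:R.
Proof.
rewrite hornerZ horner_prod; apply: (@mulfI _ s`!%:R); first by rewrite pnatr_eq0 -lt0n fact_gt0.
rewrite mulrA mulfV ?pnatr_eq0 -?lt0n ?fact_gt0 // mul1r -natrM mulnC bin_ffact.
elim: s => [|s IH]; first by rewrite big_ord0 ffactn0.
by rewrite big_ord_recr /= IH hornerD hornerX hornerC -natrD -natrM addnS mulnC -ffactSS.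
Qed.

Lemma monic_binomial_prod s :
  (\prod_(i < s) ('X + i.+1%:R%:P) : {poly rat}) \is monic /\
  size (\prod_(i < s) ('X + i.+1%:R%:P) : {poly rat}) = s.+1.
Proof.
have E : \prod_(i < s) ('X + i.+1%:R%:P : {poly rat}) = \prod_(i < s) ('X - (- i.+1%:R)%:P).
  by apply: eq_bigr => i _; rewrite polyCN opprK.
by rewrite E monic_prod_XsubC size_prod_XsubC [index_enum _]unlock -enumT size_enum_ord.
Qed.

Lemma size_binomial_poly s : size (binomial_poly s) = s.+1.
Proof.
rewrite size_scale ?(monic_binomial_prod s).2 //.
by rewrite invr_eq0 pnatr_eq0 -lt0n fact_gt0.
Qed.

Lemma binomial_poly_top s : (binomial_poly s)`_s = s`!%:R^-1.
Proof.
have [/monicP + sz] := monic_binomial_prod s.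
by rewrite lead_coefE sz coefZ /= => ->; rewrite mulr1.
Qed.

End PolyGrowth.

(** The preimage has dimension dim ker f + dim (X meet im f); rank-nullity and the formula for the
    dimension of a sum eliminate both terms. *)
Lemma dim_preim (K : fieldType) (V W : vectType K) (f : 'Hom(V, W)) (X : {vspace W}) :
  (\dim (X + limg f) + \dim (f @^-1: X) = \dim X + \dim {:V})%N.
Proof.
have e1 := limg_ker_dim f fullv; have e2 := limg_ker_dim f (f @^-1: X)%VS.
have kerS : (fullv :&: lker f)%VS = (f @^-1: X :&: lker f)%VS.
  apply/eqP; rewrite capfv eq_sym; apply/eqP/capv_idPr/subvP => v.
  by rewrite memv_ker -memv_preim => /eqP->; rewrite mem0v.
rewrite kerS in e1.
have e3 := dimv_sum_cap (limg f) X.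
have e4 : (f @: (f @^-1: X) = limg f :&: X)%VS.
  apply/eqP; rewrite eqEsubv; apply/andP; split.
    rewrite subv_cap limgS ?subvf //=; apply/subvP => _ /memv_imgP[v vU ->].
    by rewrite memv_preim.
  apply/subvP => w; rewrite memv_cap => /andP[/memv_imgP[v _ ->] vU].
  by apply: memv_img; rewrite -memv_preim.
rewrite e4 in e2; rewrite addvC; move: e1 e2 e3; clear.
move: (\dim (limg f :&: X)) (\dim (f @^-1: X :&: lker f)) => x y.
move: (\dim (limg f + X)) (\dim (limg f)) (\dim {:V}) (\dim X) (\dim (f @^-1: X)) => *.
lia.
Qed.

Section HomogMaps.
Variables (K : fieldType).

(** Taking the component of degree m' makes this linear for every g. For the maps used below, which
    send degree m to degree m', it changes nothing. *)
Definition homog_map (k l m m' : nat) (g : {linear {mpoly K[k]} -> {mpoly K[l]}})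
  (p : dhomog k K m) : dhomog l K m' := DHomog (pihomogP mdeg m' (g p)).

Lemma homog_map_is_linear k l m m' g : linear (@homog_map k l m m' g).
Proof. by move=> c p q; apply: val_inj; rewrite /homog_map /= !linearP. Qed.

HB.instance Definition _ k l m m' g :=
  GRing.isLinear.Build K (dhomog k K m) (dhomog l K m') _ (@homog_map k l m m' g)
    (@homog_map_is_linear k l m m' g).

Lemma dim_dhomog k m : \dim {:dhomog k.+1 K m} = 'C(m + k, k).
Proof. by rewrite dimvf -bin_sub ?leq_addl // addnK. Qed.

Lemma pihomog_diff n m d (p : {mpoly K[n]}) : d != m -> p \is d.-homog -> pihomog mdeg m p = 0.
Proof. by move=> dm hp; apply: pihomog_ne0 hp. Qed.

Lemma mpoly_homog_ind n (P : {mpoly K[n]} -> Prop) :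
  (forall p q, P p -> P q -> P (p + q)) -> (forall d p, p \is d.-homog -> P p) ->
  forall p, P p.
Proof.
move=> PD Ph p; rewrite (pihomog_partitionE (leqnn (msize p))).
apply: (big_ind P) => // [|i _]; first by apply: (Ph 0%N); apply: rpred0.
by apply: (Ph i); apply: pihomogP.
Qed.

Lemma pihomog_subst_mx m k (T : 'M[K]_(m, k)) d (p : {mpoly K[k]}) :
  pihomog mdeg d (subst_mx T p) = subst_mx T (pihomog mdeg d p).
Proof.
elim/mpoly_homog_ind: p => [p q hp hq|e p hp]; first by rewrite !linearD /= hp hq.
have [<-|ne] := eqVneq e d; first by rewrite !pihomog_dE //; apply: subst_mx_homog.
by rewrite !(pihomog_diff ne) ?rmorph0 //; apply: subst_mx_homog.
Qed.

Lemma pihomogM n d e (p q : {mpoly K[n]}) : q \is e.-homog ->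
  pihomog mdeg d (p * q) = if (e <= d)%N then pihomog mdeg (d - e) p * q else 0.
Proof.
move=> hq; elim/mpoly_homog_ind: p => [p p' hp hp'|c p hp].
  by rewrite mulrDl !linearD /= hp hp'; case: ifP; rewrite ?mulrDl ?addr0.
have hpq : p * q \is (c + e).-homog by apply: dhomogM.
have [<-|ne] := eqVneq (c + e)%N d; first by rewrite pihomog_dE // leq_addl addnK pihomog_dE.
rewrite (pihomog_diff ne) //; case: leqP => // ed.
by rewrite (@pihomog_diff _ _ c) ?mul0r //; lia.
Qed.

End HomogMaps.

Local Notation K := algC.

Section VarietyIdeal.
Variables (N : nat) (Z : variety N).
Implicit Types (p q : {mpoly K[N.+1]}).

Lemma variety_mul a p : p \in Z -> a * p \in Z.
Proof. by move=> pZ; rewrite -[a * p]addr0; apply: variety_lin => //; apply: variety0. Qed.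

Lemma variety_add p q : p \in Z -> q \in Z -> p + q \in Z.
Proof. by move=> pZ qZ; rewrite -[p]mul1r; apply: variety_lin. Qed.

Lemma variety_sum (I : Type) (r : seq I) (P : pred I) (F : I -> {mpoly K[N.+1]}) :
  (forall i, P i -> F i \in Z) -> \sum_(i <- r | P i) F i \in Z.
Proof.
move=> h; apply: (big_ind (fun p => p \in Z)) => //; first exact: variety0.
exact: variety_add.
Qed.

(** The ideal is generated by forms, and a homogeneous component of a multiple of a form is again a
    multiple of it. *)
Lemma variety_pihomog d p : p \in Z -> pihomog mdeg d p \in Z.
Proof.
case: (variety_forms Z) => G homG genG /genG[c ->].
rewrite linear_sum; apply: variety_sum => i _ /=.
have [e he] : exists e, G`_i \is e.-homog by apply: homG; apply: mem_nth.
have GZ : G`_i \in Z.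
  apply/genG; exists (fun j : nat => (j == i :> nat)%:R).
  rewrite (bigD1 i) //= eqxx mul1r big1 ?addr0 // => j ji.
  by rewrite [(_ == _ :> nat)]val_eqE (negPf ji) mul0r.
rewrite (pihomogM _ _ he); case: ifP => _; [exact: variety_mul | exact: variety0].
Qed.

Definition subst_lfun (k m : nat) (T : 'M[K]_(N.+1, k.+1)) :
    'Hom(dhomog k.+1 K m, dhomog N.+1 K m) := linfun (homog_map m (subst_mx T)).

(** The forms of degree m that vanish on the image of Z under T, taken in the ideal-theoretic
    sense. *)
Definition relations (k m : nat) (T : 'M[K]_(N.+1, k.+1)) :
    {vspace dhomog k.+1 K m} := (subst_lfun m T @^-1: ideal_part Z m)%VS.

Lemma mem_relations k m (T : 'M[K]_(N.+1, k.+1)) (p : dhomog k.+1 K m) :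
  (p \in relations m T) = (subst_mx T p \in Z).
Proof.
rewrite -memv_preim mem_ideal_part lfunE /= pihomog_dE //.
exact/subst_mx_homog/dhomog_is_dhomog.
Qed.

(* The Hilbert function of the image of Z under the linear map T. *)
Definition image_hilbert (k m : nat) (T : 'M[K]_(N.+1, k.+1)) : nat :=
  ('C(m + k, k) - \dim (relations m T))%N.

Lemma image_hilbertE k m (T : 'M[K]_(N.+1, k.+1)) :
  (\dim (ideal_part Z m + limg (subst_lfun m T)) =
   \dim (ideal_part Z m) + image_hilbert m T)%N.
Proof.
have := dim_preim (subst_lfun m T) (ideal_part Z m).
rewrite dim_dhomog -/(relations m T) /image_hilbert.
have := dimvS (subvf (relations m T)); rewrite dim_dhomog.
move: (\dim _) (\dim _) (\dim _) 'C(_, _) => *; lia.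
Qed.

Lemma hilbert_funE m : (hilbert_fun Z m + \dim (ideal_part Z m) = 'C(m + N, N))%N.
Proof. by rewrite /hilbert_fun dim_dhomog subnK // -(dim_dhomog K) dimvS ?subvf. Qed.

Lemma image_hilbert_le k m (T : 'M[K]_(N.+1, k.+1)) :
  (image_hilbert m T <= hilbert_fun Z m)%N.
Proof.
have := image_hilbertE m T; have := hilbert_funE m.
have := dimvS (subvf (ideal_part Z m + limg (subst_lfun m T))%VS); rewrite dim_dhomog.
move: (\dim _) (\dim _) (hilbert_fun _ _) 'C(_, _) (image_hilbert _ _) => *; lia.
Qed.

(** The classes of the t j generate the coordinate ring as a module over the subring generated by
    the linear forms given by the columns of T. As J is finite, this is finiteness of the projection
    T on Z. *)
Definition generates (k : nat) (T : 'M[K]_(N.+1, k)) (J : finType)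
    (t : J -> {mpoly K[N.+1]}) : Prop :=
  forall p, exists q : J -> {mpoly K[k]}, p - \sum_j subst_mx T (q j) * t j \in Z.

Lemma generates_homog k (T : 'M[K]_(N.+1, k)) (J : finType) t (e : J -> nat) m p :
  (forall j, t j \is (e j).-homog) -> generates T t -> p \is m.-homog ->
  exists2 q : J -> {mpoly K[k]}, p - \sum_(j | (e j <= m)%N) subst_mx T (q j) * t j \in Z
    & forall j, q j \is (m - e j).-homog.
Proof.
move=> ht gen hp; have [q qZ] := gen p.
exists (fun j => pihomog mdeg (m - e j) (q j)); last by move=> j; apply: pihomogP.
set u := (X in X \in _); suff -> : u = pihomog mdeg m (p - \sum_j subst_mx T (q j) * t j).
  exact: variety_pihomog.
rewrite /u [RHS]linearB /= pihomog_dE //; congr (_ - _); rewrite linear_sum /=.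
rewrite big_mkcond /=; apply: eq_bigr => j _.
by rewrite (pihomogM _ _ (ht j)) pihomog_subst_mx.
Qed.

Definition mul_subst (k : nat) (T : 'M[K]_(N.+1, k)) (t : {mpoly K[N.+1]})
  (q : {mpoly K[k]}) : {mpoly K[N.+1]} := subst_mx T q * t.

Lemma mul_subst_is_linear k T t : linear (@mul_subst k T t).
Proof. by move=> c p q; rewrite /mul_subst linearP mulrDl scalerAl. Qed.

HB.instance Definition _ k T t :=
  GRing.isLinear.Build K {mpoly K[k]} {mpoly K[N.+1]} _ (@mul_subst k T t)
    (@mul_subst_is_linear k T t).

(** The degree m part of the coordinate ring is the sum of the products of t j with the degree m - e
    j part of the subring, and such a product has at most the dimension of its second factor. *)
Lemma hilbert_fun_cover k (T : 'M[K]_(N.+1, k.+1)) (J : finType) t (e : J -> nat) m :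
  (forall j, t j \is (e j).-homog) -> generates T t ->
  (hilbert_fun Z m <= \sum_(j | (e j <= m)%N) image_hilbert (m - e j) T)%N.
Proof.
move=> ht gen; set I := ideal_part Z m.
pose g j : 'Hom(dhomog k.+1 K (m - e j), dhomog N.+1 K m) :=
  linfun (homog_map m (mul_subst T (t j))).
have gE j (q : dhomog k.+1 K (m - e j)) : (e j <= m)%N ->
    mpoly_of_dhomog (g j q) = subst_mx T q * t j.
  move=> ejm; rewrite lfunE /= pihomog_dE // -[X in _ \is X.-homog](subnK ejm).
  by apply: dhomogM => //; apply/subst_mx_homog/dhomog_is_dhomog.
(* The generators are added one at a time, so the space already reached has to be an arbitrary W
   containing the ideal. *)
suff H (r : seq J) (W : {vspace dhomog N.+1 K m}) : (I <= W)%VS ->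
    (\dim (W + \sum_(j <- r | (e j <= m)%N) limg (g j))%VS
     <= \dim W + \sum_(j <- r | (e j <= m)%N) image_hilbert (m - e j) T)%N.
  have := H (index_enum J) I (subvv _).
  suff -> : (I + \sum_(j | (e j <= m)%N) limg (g j) = fullv)%VS.
    by rewrite dim_dhomog -(hilbert_funE m) addnC leq_add2l.
  apply/eqP; rewrite eqEsubv subvf /=; apply/subvP => p _.
  have [q qZ hq] := generates_homog ht gen (dhomog_is_dhomog p).
  pose s := \sum_(j | (e j <= m)%N) g j (DHomog (hq j)).
  rewrite -(subrK s p); apply: memv_add.
    rewrite mem_ideal_part linearB /= raddf_sum /=.
    by rewrite (eq_bigr (fun j => subst_mx T (q j) * t j)) // => j ejm; rewrite gE.
  apply: memv_suml => j ejm; apply: subvP (sumv_sup j _ _) _ _ => //.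
  by apply: memv_img; apply: memvf.
elim: r W => [|j r IH] W IW; first by rewrite !big_nil addv0 addn0.
rewrite !big_cons; case: ifP => ejm; last exact: IH.
rewrite addvA addnA; apply: leq_trans (IH _ (subv_trans IW (addvSl _ _))) _.
rewrite leq_add2r.
have sub : (relations (m - e j) T <= g j @^-1: W)%VS.
  apply/subvP => q; rewrite mem_relations -memv_preim => qZ.
  by apply: (subvP IW); rewrite mem_ideal_part gE // mulrC; apply: variety_mul.
have := dim_preim (g j) W; have := dimvS sub; rewrite dim_dhomog /image_hilbert; clear.
move: (\dim (W + limg (g j))%VS) (\dim (g j @^-1: W)%VS) (\dim (relations (m - e j) T)) (\dim W) (binomial _ _) => *; lia.
Qed.

End VarietyIdeal.

(** * Projections to hypersurfaces *)

Section FormsMul.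
Variables (K : fieldType) (k : nat).
Implicit Types F G : {mpoly K[k.+1]}.

Definition mul_form F (m m' : nat) : 'Hom(dhomog k.+1 K m, dhomog k.+1 K m') :=
  linfun (homog_map m' (F \*o idfun)).

Lemma mul_formE F D m (p : dhomog k.+1 K (m - D)) : F \is D.-homog -> (D <= m)%N ->
  mpoly_of_dhomog (mul_form F (m - D) m p) = F * p.
Proof.
move=> hF Dm; rewrite lfunE /= pihomog_dE // -[X in _ \is X.-homog](subnKC Dm).
by apply: dhomogM => //; apply: dhomog_is_dhomog.
Qed.

Lemma homog_quotient F D m (p u : {mpoly K[k.+1]}) : F \is D.-homog -> (D <= m)%N ->
  p \is m.-homog -> p = u * F -> exists w : dhomog k.+1 K (m - D), p = F * w.
Proof.
move=> hF Dm hp e; exists (DHomog (pihomogP mdeg (m - D) u)).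
by rewrite /= mulrC -[LHS](pihomog_dE hp) {1}e (pihomogM _ _ hF) Dm.
Qed.

Lemma dim_limg_mul_form F D m : F != 0 -> F \is D.-homog -> (D <= m)%N ->
  \dim (limg (mul_form F (m - D) m)) = 'C(m - D + k, k).
Proof.
move=> F0 hF Dm; rewrite limg_dim_eq ?dim_dhomog //.
apply/eqP; rewrite -subv0; apply/subvP => p; rewrite memv_cap memv_ker memv0 => /andP[_ /eqP e].
have := mul_formE p hF Dm; rewrite e raddf0 => /esym/eqP.
by rewrite mulf_eq0 (negPf F0) /= => /eqP p0; apply/eqP/val_inj.
Qed.

(** In degree m the ideals (F) and (G) meet inside (F G): if F p = G q, the prime F divides q and p
    is a multiple of G. The rest is the dimension formula for a sum. *)
Lemma dim_coprime_forms F G D E m : F != 0 -> G != 0 -> F \is D.-homog -> G \is E.-homog ->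
  prime_elt F -> ~ divides F G -> (D + E <= m)%N ->
  ('C(m - D + k, k) + 'C(m - E + k, k) <=
   \dim (limg (mul_form F (m - D) m) + limg (mul_form G (m - E) m))%VS + 'C(m - (D + E) + k, k))%N.
Proof.
move=> F0 G0 hF hG [_ _ pF] nFG DEm.
have Dm : (D <= m)%N by apply: leq_trans DEm; apply: leq_addr.
have Em : (E <= m)%N by apply: leq_trans DEm; apply: leq_addl.
have := dim_preim (mul_form F (m - D) m) (limg (mul_form G (m - E) m)).
rewrite dim_dhomog dim_limg_mul_form // addvC => e.
suff le : (\dim (mul_form F (m - D) m @^-1: limg (mul_form G (m - E) m)) <= 'C(m - (D + E) + k, k))%N.
  rewrite addnC -e leq_add2l //.
have EmD : (E <= m - D)%N by rewrite leq_subRL.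
rewrite subnDA -(dim_limg_mul_form G0 hG EmD); apply: dimvS; apply/subvP => p.
rewrite -memv_preim => /memv_imgP[q _ /(congr1 (@mpoly_of_dhomog _ _ _))].
rewrite !mul_formE // => epq.
have [|//|[w ew]] := pF G (mpoly_of_dhomog q); first by exists (mpoly_of_dhomog p); rewrite -epq mulrC.
have ep : mpoly_of_dhomog p = w * G.
  by apply: (mulfI F0); rewrite epq ew; ring.
have [w' ew'] := homog_quotient hG EmD (dhomog_is_dhomog p) ep.
suff -> : p = mul_form G (m - D - E) (m - D) w' by apply: memv_img; apply: memvf.
by apply: val_inj; rewrite /= ew' mul_formE.
Qed.

End FormsMul.

Section SecondDifference.
Variables (k D E : nat).

(** The Hilbert polynomial of a complete intersection of degrees D and E in projective k-space; its
    degree is at most k - 2 when k is at least 2. *)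
Definition second_difference : {poly rat} :=
  let P := binomial_poly k - pshift D%:R (binomial_poly k) in P - pshift E%:R P.

Lemma size_second_difference : (size second_difference <= k.-1)%N.
Proof.
have const (P : {poly rat}) c : (size P <= 1)%N -> P - pshift c P = 0.
  by move=> /size1_polyC->; rewrite /pshift comp_polyC subrr.
rewrite /second_difference; case: k => [|[|s]].
- by rewrite !const ?size_binomial_poly ?size_poly0.
- by rewrite const ?size_poly0 // (pshift_diff _ _).1 // size_binomial_poly.
apply: (pshift_diff _ _).1; apply: (pshift_diff _ _).1.
by rewrite size_binomial_poly.
Qed.

Lemma horner_second_difference m : (D + E <= m)%N ->
  second_difference.[m%:R] + 'C(m - D + k, k)%:R + 'C(m - E + k, k)%:R =
  'C(m + k, k)%:R + 'C(m - (D + E) + k, k)%:R.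
Proof.
move=> DEm; have Dm : (D <= m)%N by apply: leq_trans DEm; apply: leq_addr.
have Em : (E <= m)%N by apply: leq_trans DEm; apply: leq_addl.
have eDE : m%:R - E%:R - D%:R = (m - (D + E))%:R :> rat.
  by rewrite -natrB // -natrB ?leq_subRL // ?[(E + D)%N]addnC // -subnDA addnC.
rewrite /second_difference !(hornerD, hornerN, horner_pshift) eDE -!natrB //.
by rewrite !horner_binomial_poly; ring.
Qed.

End SecondDifference.

(** Dimension and degree carried by one polynomial, whereas [has_dim] and [has_degree] each provide
    their own. *)
Definition hilbert_asymp (N : nat) (Z : variety N) (r d : nat) : Prop :=
  exists (P : {poly rat}) (m0 : nat),
    [/\ size P = r.+1, P`_r = d%:R / r`!%:R
      & forall m : nat, (m0 <= m)%N -> P.[m%:R] = (hilbert_fun Z m)%:R].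

(** The two Hilbert polynomials agree for large m, so [poly_le_coef] in both directions equates
    their top coefficients. The case P = 0 is excluded because it would give degree 0. *)
Lemma has_dim_degree_asymp N (Z : variety N) r d : (0 < d)%N ->
  has_degree Z d -> has_dim Z r -> hilbert_asymp Z r d.
Proof.
move=> d0 [P [m0 hP] lP] [Q [m1 hQ] sQ]; exists Q, (maxn m0 m1).
have PQ (m : nat) : (maxn m0 m1 <= m)%N -> P.[m%:R] = Q.[m%:R].
  by rewrite geq_max => /andP[/hP-> /hQ->].
have coefE s : (size P <= s.+1)%N -> (size Q <= s.+1)%N -> P`_s = Q`_s.
  move=> sP sQ'; apply/eqP; rewrite eq_le.
  by rewrite !(@poly_le_coef _ _ s (maxn m0 m1)) // => m /PQ->.
have P0 : P != 0.
  apply/eqP => e; move: lP; rewrite e lead_coef0 mul0r => /esym/eqP.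
  by rewrite pnatr_eq0 -leqn0 leqNgt d0.
have sP : size P = r.+1.
  have : (0 < size P)%N by rewrite size_poly_gt0.
  case: (ltngtP (size P) r.+1) => // [lt|lt _].
    have e := coefE r (ltnW lt) (eq_leq sQ); move: (lead_coef_eq0 Q).
    rewrite lead_coefE sQ /= -e nth_default ?eqxx //.
    by rewrite -size_poly_eq0 sQ.
  have e : P`_(size P).-1 = Q`_(size P).-1.
    by apply: coefE; rewrite prednK ?size_poly_gt0 // sQ ltnW.
  move: P0; rewrite -lead_coef_eq0 lead_coefE e nth_default ?eqxx // sQ -ltnS.
  by rewrite prednK // (leq_trans _ lt).
split=> //; last by move=> m; rewrite geq_max => /andP[_ /hQ].
rewrite -coefE ?sP ?sQ //; move: lP; rewrite lead_coefE sP /= => <-.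
by rewrite mulfK // pnatr_eq0 -lt0n fact_gt0.
Qed.

Section Hypersurface.
Variables (N r d : nat) (Z : variety N).
Hypotheses (intZ : geom_integral Z) (asymp : hilbert_asymp Z r d).

Lemma variety1 : 1 \notin Z.
Proof.
case: intZ => _ [i]; apply: contra => Z1.
by rewrite -['X_i]mulr1; apply: variety_mul.
Qed.

Lemma variety_const c : c%:MP \in Z -> c = 0.
Proof.
move=> cZ; apply/eqP; apply: contraNT variety1 => c0.
have <- : c^-1%:MP * c%:MP = 1 :> {mpoly K[N.+1]} by rewrite -mpolyCM mulVf // mpolyC1.
exact: variety_mul.
Qed.

Lemma variety_prime p q : p * q \in Z -> p \in Z \/ q \in Z.
Proof. by case: intZ => prZ _ /prZ/orP. Qed.

(** Without relations the image would have Hilbert function 'C(m + k, k), of order m^k, which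
    exceeds the order m^r available on Z. *)
Lemma relation_exists k (T : 'M[K]_(N.+1, k.+1)) : (r < k)%N ->
  exists e (F : {mpoly K[k.+1]}), [/\ F != 0, F \is e.-homog & subst_mx T F \in Z].
Proof.
move=> rk; apply: contrapT => nex; case: asymp => P [m0 [sP _ hP]].
have rel0 m : \dim (relations Z m T) = 0%N.
  apply/eqP; rewrite dimv_eq0 -subv0; apply/subvP => p.
  rewrite mem_relations memv0 => pZ; apply: contraT => p0; case: nex.
  exists m, p; split=> //; exact: dhomog_is_dhomog.
have : (binomial_poly k)`_k <= P`_k.
  apply: (@poly_le_coef _ _ _ m0); rewrite ?size_binomial_poly ?sP ?(leq_trans rk) //.
  move=> m /hP->; rewrite horner_binomial_poly ler_nat.
  by have := image_hilbert_le Z m T; rewrite /image_hilbert rel0 subn0.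
rewrite binomial_poly_top [P`_k]nth_default ?sP // leNgt.
by rewrite invr_gt0 ltr0n fact_gt0.
Qed.

(** A relation of least degree is irreducible: the ideal is prime, so one factor is itself a
    relation, has the full degree, and leaves a constant cofactor. *)
Lemma minimal_relation k (T : 'M[K]_(N.+1, k.+1)) : (r < k)%N ->
  exists D (F : {mpoly K[k.+1]}),
    [/\ F \is D.-homog, irreducible_elt F & subst_mx T F \in Z].
Proof.
move=> rk; have [e [F [F0 _ FZ]]] := relation_exists T rk.
pose Q s := `[< exists F : {mpoly K[k.+1]}, [/\ F != 0, subst_mx T F \in Z & msize F = s] >].
have exQ : exists s, Q s by exists (msize F); apply/asboolP; exists F.
case: (ex_minnP exQ) => s /asboolP[{e F0 FZ}F [F0 FZ sF]] smin.
have minF G : G != 0 -> subst_mx T G \in Z -> (s <= msize G)%N.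
  by move=> G0 GZ; apply: smin; apply/asboolP; exists G.
(* The degree is s - 1. The top component of a relation of least size is again a relation, and it
   makes the choice homogeneous. *)
set D := s.-1; exists D, (pihomog mdeg D F); set G := pihomog mdeg D F.
have homG : G \is D.-homog by apply: pihomogP.
have GZ : subst_mx T G \in Z by rewrite -pihomog_subst_mx; apply: variety_pihomog.
have s0 : (0 < s)%N by rewrite -sF lt0n msize_poly_eq0.
have G0 : G != 0.
  apply/eqP => /(congr1 (mcoeff (mlead F))); rewrite mcoeff0 /G pihomogE raddf_sum /=.
  rewrite big_mkcond (bigD1_seq (mlead F)) ?mlead_supp ?msupp_uniq //=.
  rewrite ifT; last by apply/eqP; rewrite /D -sF -mlead_deg.
  rewrite mcoeffZ mcoeffX eqxx mulr1 big1 ?addr0.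
    by apply/eqP; rewrite mleadc_eq0.
  move=> m ml; case: ifP => // _; rewrite mcoeffZ mcoeffX (negPf ml) mulr0 //.
have sG : msize G = s.
  apply/eqP; rewrite eqn_leq minF // andbT.
  by move: (dhomog_msize homG) => /(dhomog_uniq G0 homG); rewrite /D /=; lia.
split=> //; split=> // [|a b e].
  rewrite mpoly_unit_msize; apply: contra G0 => /msize_poly1P[c c0 e].
  by move: GZ; rewrite e subst_mxC => /variety_const->; rewrite mpolyC0.
move: G0; rewrite e mulf_eq0 negb_or => /andP[a0 b0].
rewrite !mpoly_unit_msize; move: sG; rewrite e msizeM //.
have := a0; have := b0; rewrite -!msize_poly_eq0.
move: GZ; rewrite e rmorphM => /variety_prime[] /minF => [/(_ a0)|/(_ b0)].
  by move: (msize a) (msize b) => x y *; right; apply/eqP; lia.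
by move: (msize a) (msize b) => x y *; left; apply/eqP; lia.
Qed.

Variables (J : finType) (t : J -> {mpoly K[N.+1]}) (e : J -> nat).
Variable (T : 'M[K]_(N.+1, r.+2)).
Hypotheses (d0 : (0 < d)%N) (homt : forall j, t j \is (e j).-homog) (gen : generates Z T t).

(** By finiteness the Hilbert function of Z is at most a sum of #|J| shifts of Q. Shifts keep the
    coefficient of X^r, so #|J| times it is at least d / r!, which is positive. *)
Lemma asymp_coef_le (Q : {poly rat}) m0 : (size Q <= r.+1)%N ->
  (forall m : nat, (m0 <= m)%N -> (image_hilbert Z m T)%:R <= Q.[m%:R]) -> 0 < Q`_r.
Proof.
move=> sQ hQ; case: asymp => P [m1 [sP cP hP]].
pose S := \sum_(j : J) pshift (e j)%:R Q.
have sS : (size S <= r.+1)%N.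
  apply: leq_trans (size_sum _ _ _) _; apply/bigmax_leqP => j _.
  by rewrite size_pshift.
have : P`_r <= S`_r.
  apply: (@poly_le_coef _ _ _ (maxn m1 (m0 + \max_j e j))); rewrite ?sP // => m.
  rewrite geq_max => /andP[/hP-> hm].
  have em j : (e j + m0 <= m)%N.
    by rewrite addnC (leq_trans _ hm) // leq_add2l leq_bigmax.
  apply: le_trans (_ : (\sum_(j | (e j <= m)%N) image_hilbert Z (m - e j) T)%:R <= _).
    by rewrite ler_nat; apply: hilbert_fun_cover.
  rewrite horner_sum natr_sum big_mkcond; apply: ler_sum => j _.
  have ejm : (e j <= m)%N := leq_trans (leq_addr m0 _) (em j).
  rewrite ejm horner_pshift.
  have -> : m%:R - (e j)%:R = (m - e j)%:R :> rat by rewrite natrB.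
  by apply: hQ; rewrite leq_subRL.
rewrite cP /S coef_sum (eq_bigr (fun=> Q`_r)) => [|j _]; last exact: coef_pshift_top.
have lc : 0 < d%:R / r`!%:R :> rat by rewrite divr_gt0 ?ltr0n ?fact_gt0.
rewrite sumr_const => /(lt_le_trans lc); rewrite !ltNge; apply: contra => Q0.
exact: mulrn_wle0.
Qed.

Lemma second_difference_nat (k D E m x : nat) : (D + E <= m)%N ->
  (x <= 'C(m + k, k))%N ->
  ('C(m - D + k, k) + 'C(m - E + k, k) <= x + 'C(m - (D + E) + k, k))%N ->
  ('C(m + k, k) - x)%N%:R <= (second_difference k D E).[m%:R].
Proof.
move=> DEm; have := horner_second_difference k DEm.
move: 'C(m + k, k) 'C(m - D + k, k) 'C(m - E + k, k) 'C(m - (D + E) + k, k) => a b c u h xa.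
rewrite -(ler_nat rat) !natrD natrB //; lra.
Qed.

(** Otherwise the image would lie in a complete intersection of dimension r - 1, too small for a
    finite projection of Z. *)
Lemma homog_relation_divides D E F G : F \is D.-homog -> G \is E.-homog ->
  prime_elt F -> subst_mx T F \in Z -> subst_mx T G \in Z -> divides F G.
Proof.
move=> homF homG prF FZ GZ; have [F0 _ _] := prF; apply: contrapT => nFG.
have G0 : G != 0 by apply: contra_notN nFG => /eqP->; exists 0; rewrite mul0r.
suff : 0 < (second_difference r.+1 D E)`_r.
  by rewrite nth_default ?ltxx ?size_second_difference.
apply: (@asymp_coef_le _ (D + E)); first exact: leq_trans (size_second_difference _ _ _) (leqnSn _).
move=> m DEm; apply: second_difference_nat => //.
  by rewrite -(dim_dhomog K); apply: dimvS; apply: subvf.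
apply: leq_trans (dim_coprime_forms F0 G0 homF homG prF nFG DEm) _.
rewrite leq_add2r; apply: dimvS.
have Dm : (D <= m)%N by apply: leq_trans DEm; apply: leq_addr.
have Em : (E <= m)%N by apply: leq_trans DEm; apply: leq_addl.
rewrite subv_add; apply/andP; split; apply/subvP => _ /memv_imgP[p _ ->].
  by rewrite mem_relations mul_formE // rmorphM mulrC; apply: variety_mul.
by rewrite mem_relations mul_formE // rmorphM mulrC; apply: variety_mul.
Qed.

(** A finite image in projective (r + 1)-space is a hypersurface: the minimal relation divides each
    homogeneous component of any other. The last clause is the Hilbert function of a hypersurface of
    degree D. *)
Lemma relations_principal : exists D (F : {mpoly K[r.+2]}),
  [/\ F \is D.-homog, irreducible_elt F,
      forall G, subst_mx T G \in Z <-> divides F G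
    & forall m, (D <= m)%N -> (image_hilbert Z m T + 'C(m - D + r.+1, r.+1) = 'C(m + r.+1, r.+1))%N].
Proof.
have [D [F [homF irrF FZ]]] := minimal_relation T (ltnSn r).
have prF := mpoly_irreducible_prime irrF; have [F0 _ _] := prF.
have FM G : divides F G -> subst_mx T G \in Z.
  by case=> u ->; rewrite rmorphM; apply: variety_mul.
have princ G : subst_mx T G \in Z <-> divides F G.
  split=> [GZ|]; last exact: FM.
  rewrite (pihomog_partitionE (leqnn (msize G))); apply: divides_sum => i _.
  apply: (homog_relation_divides homF _ prF FZ); first exact: pihomogP.
  by rewrite -pihomog_subst_mx; apply: variety_pihomog.
exists D, F; split=> // m Dm.
suff : \dim (relations Z m T) = 'C(m - D + r.+1, r.+1).
  move=> <-; rewrite /image_hilbert subnK // -(dim_dhomog K); apply: dimvS; apply: subvf.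
rewrite -(dim_limg_mul_form F0 homF Dm); congr (\dim _); apply/eqP.
rewrite eqEsubv; apply/andP; split; apply/subvP => p.
  rewrite mem_relations => /princ[u eu].
  have [w ew] := homog_quotient homF Dm (dhomog_is_dhomog p) eu.
  suff -> : p = mul_form F (m - D) m w by apply: memv_img; apply: memvf.
  by apply: val_inj; rewrite /= ew mul_formE.
move=> /memv_imgP[w _ ->]; rewrite mem_relations mul_formE // rmorphM mulrC.
exact: variety_mul.
Qed.

End Hypersurface.

Section HypersurfaceDegree.
Variables (N r d : nat) (Z : variety N).
Hypotheses (intZ : geom_integral Z) (asymp : hilbert_asymp Z r d).
Variables (T : 'M[K]_(N.+1, r.+2)) (D : nat).
Hypothesis (hT : forall m, (D <= m)%N ->
  (image_hilbert Z m T + 'C(m - D + r.+1, r.+1) = 'C(m + r.+1, r.+1))%N).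

(** The Hilbert polynomial of a hypersurface of degree D in projective (r + 1)-space, with leading
    coefficient D / r! if D > 0. *)
Definition first_difference : {poly rat} :=
  binomial_poly r.+1 - pshift D%:R (binomial_poly r.+1).

Lemma size_first_difference : (size first_difference <= r.+1)%N.
Proof. by apply: (pshift_diff _ _).1; rewrite size_binomial_poly. Qed.

Lemma first_difference_top : first_difference`_r = D%:R / r`!%:R.
Proof.
rewrite (pshift_diff _ _).2 ?size_binomial_poly // binomial_poly_top factS natrM invfM.
by rewrite mulrAC mulrA mulfV ?pnatr_eq0 // mul1r mulrC.
Qed.

Lemma horner_first_difference m : (D <= m)%N ->
  first_difference.[m%:R] = (image_hilbert Z m T)%:R.
Proof.
move=> Dm; rewrite hornerD hornerN horner_pshift -natrB // !horner_binomial_poly.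
by rewrite -(hT Dm) natrD addrK.
Qed.

Lemma hypersurface_degree_le : (D <= d)%N.
Proof.
case: asymp => P [m0 [sP cP hP]].
have : first_difference`_r <= P`_r.
  apply: (@poly_le_coef _ _ _ (maxn m0 D)); rewrite ?sP ?size_first_difference // => m.
  rewrite geq_max => /andP[/hP-> /horner_first_difference->].
  by rewrite ler_nat; apply: image_hilbert_le.
rewrite first_difference_top cP ler_pM2r ?ler_nat //.
by rewrite invr_gt0 ltr0n fact_gt0.
Qed.

(** Multiplication by a denominator a embeds the coordinate ring of Z into that of the image with a
    fixed shift of degree, and a shift does not affect leading coefficients. *)
Lemma hypersurface_degree_ge a : a \notin Z ->
  (forall p, exists q, a * p - subst_mx T q \in Z) -> (d <= D)%N.
Proof.
move=> aZ hp.
(* The denominator need not be homogeneous; a component of it outside the ideal serves to multiply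
   forms. *)
have [s asZ] : exists s, pihomog mdeg s a \notin Z.
  apply: contrapT => nex; case/negP: aZ.
  rewrite (pihomog_partitionE (leqnn (msize a))); apply: variety_sum => i _.
  by apply: contraT => h; case: nex; exists i.
set c := pihomog mdeg s a in asZ; have homc : c \is s.-homog by apply: pihomogP.
have le m : (hilbert_fun Z m <= image_hilbert Z (m + s) T)%N.
  pose f : 'Hom(dhomog N.+1 K m, dhomog N.+1 K (m + s)) := linfun (homog_map (m + s) (c \*o idfun)).
  have fE p : mpoly_of_dhomog (f p) = c * p.
    rewrite lfunE /= pihomog_dE // addnC; apply: dhomogM => //; exact: dhomog_is_dhomog.
  have := dim_preim f (ideal_part Z (m + s)).
  have sub : (f @^-1: ideal_part Z (m + s) <= ideal_part Z m)%VS.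
    apply/subvP => p; rewrite -memv_preim !mem_ideal_part fE.
    by case/(variety_prime intZ) => // cZ; rewrite cZ in asZ.
  have sub2 : (ideal_part Z (m + s) + limg f <= ideal_part Z (m + s) + limg (subst_lfun (m + s) T))%VS.
    rewrite subv_add addvSl /=; apply/subvP => _ /memv_imgP[p _ ->].
    have [q hq] := hp p.
    pose q' := DHomog (pihomogP mdeg (m + s) q).
    rewrite -(subrK (subst_lfun (m + s) T q') (f p)); apply: memv_add; last by apply: memv_img; apply: memvf.
    rewrite mem_ideal_part linearB /= fE.
    have -> : mpoly_of_dhomog (subst_lfun (m + s) T q') = subst_mx T (pihomog mdeg (m + s) q).
      rewrite lfunE /= pihomog_dE //; apply: subst_mx_homog; exact: pihomogP.
    have homp : mpoly_of_dhomog p \is m.-homog by apply: dhomog_is_dhomog.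
    have -> : c * p = pihomog mdeg (m + s) (a * p).
      by rewrite (pihomogM _ _ homp) leq_addr addKn.
    by rewrite -pihomog_subst_mx -linearB; apply: variety_pihomog.
  move: (dimvS sub) (dimvS sub2) (hilbert_funE Z m).
  rewrite image_hilbertE dim_dhomog.
  move: (\dim (f @^-1: ideal_part Z (m + s))%VS) (\dim (ideal_part Z (m + s) + limg f)%VS).
  move: (\dim (ideal_part Z m)) (\dim (ideal_part Z (m + s))) (hilbert_fun Z m) (image_hilbert Z _ T) 'C(m + N, N).
  move=> *; lia.
case: asymp => P [m0 [sP cP hP]].
have : P`_r <= (pshift (- s%:R) first_difference)`_r.
  apply: (@poly_le_coef _ _ _ (maxn m0 D)); rewrite ?sP ?size_pshift ?size_first_difference // => m.
  rewrite geq_max => /andP[/hP-> Dm]; rewrite horner_pshift opprK -natrD.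
  by rewrite horner_first_difference ?ler_nat ?le // (leq_trans Dm) // leq_addr.
rewrite coef_pshift_top ?size_first_difference // first_difference_top cP ler_pM2r ?ler_nat //.
by rewrite invr_gt0 ltr0n fact_gt0.
Qed.

End HypersurfaceDegree.

Lemma char_zero_num (F : numDomainType) : char_zero F.
Proof. by move=> n /eqP; rewrite pnatr_eq0 => /eqP. Qed.

(** * Successive projections and relations of degree at most d *)

Section Descent.
Variables (N : nat) (Z : variety N).

(** Dividing the coefficients q j by the relation G leaves powers of X_0 below e, which join the t j
    as new generators. *)
Lemma generates_proj k (T : 'M[K]_(N.+1, k.+1)) (J : finType) (t : J -> {mpoly K[N.+1]})
    e (G : {mpoly K[k.+1]}) (a : 'I_k -> K) :
  G \is e.-homog -> subst_mx T G \in Z -> G.@[proj_centre a] != 0 ->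
  generates Z T t ->
  generates Z (T *m proj_mx a) (fun js : J * 'I_e => t js.1 * subst_mx T 'X_ord0 ^+ js.2).
Proof.
move=> homG GZ Ga gen p; have [q hq] := gen p.
have /choice[ru hru] : forall j, exists ru : ('I_e -> {mpoly K[k]}) * {mpoly K[k.+1]},
    q j = \sum_s subst_mx (proj_mx a) (ru.1 s) * 'X_ord0 ^+ s + ru.2 * G.
  by move=> j; have [r [u e']] := proj_division homG Ga (q j); exists (r, u).
exists (fun js => (ru js.1).1 js.2).
rewrite -(subrK (\sum_j subst_mx T (q j) * t j) p) -addrA; apply: variety_add => //.
rewrite -(pair_bigA _ (fun j s => subst_mx (T *m proj_mx a) ((ru j).1 s) * (t j * subst_mx T 'X_ord0 ^+ s))) /=.
rewrite -sumrB; apply: variety_sum => j _.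
rewrite [X in subst_mx T X]hru rmorphD rmorph_sum mulrDl mulr_suml addrAC -sumrB big1 ?add0r => [|s _].
  by rewrite rmorphM mulrAC; apply: variety_mul.
by rewrite rmorphM rmorphXn /= subst_mx_comp; ring.
Qed.

Variables (r d : nat).
Hypotheses (intZ : geom_integral Z) (asymp : hilbert_asymp Z r d) (d0 : (0 < d)%N).

(** Project until r + 2 linear forms remain, where the equation of the image has degree at most d,
    then pull that equation back. Pulling back preserves degree, so the degrees of the auxiliary
    relations do not matter. *)
Lemma small_relation k (T : 'M[K]_(N.+1, k.+1)) (J : finType) t (e : J -> nat) :
  (r < k)%N -> (forall j, t j \is (e j).-homog) -> generates Z T t ->
  exists c (F : {mpoly K[k.+1]}), [/\ (c <= d)%N, F != 0, F \is c.-homog & subst_mx T F \in Z].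
Proof.
elim: k T J t e => [//|k IH] T J t e rk homt gen.
have [krE|kr] := eqVneq k r.
  subst k; have [D [F [homF irrF FZ hD]]] := relations_principal intZ asymp d0 homt gen.
  have [F0 _ _] := irrF.
  exists D, F; split=> //; first exact: (hypersurface_degree_le asymp hD).
  by apply/FZ; exists 1; rewrite mul1r.
have rk' : (r < k)%N by rewrite ltn_neqAle eq_sym kr -ltnS.
have [c [G [G0 homG GZ]]] := relation_exists asymp T rk.
have [a _ Ga] := proj_centre_exists homG (@char_zero_num _) G0.
have gen' := generates_proj homG GZ Ga gen.
have homt' (js : J * 'I_c) : t js.1 * subst_mx T 'X_ord0 ^+ js.2 \is (e js.1 + js.2).-homog.
  apply: dhomogM => //; rewrite -[X in _ \is X.-homog]mul1n; apply: dhomogMn.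
  by apply: subst_mx_homog; rewrite dhomogX; apply/eqP/mdeg1.
have [c' [F [c'd F0 homF FZ]]] := IH _ _ _ _ rk' homt' gen'.
exists c', (subst_mx (proj_mx (fun i => (a i)%:R)) F); split=> //.
- by apply: contra_neq F0 => e0; apply: (@subst_proj_mx_inj _ _ (fun i => (a i)%:R)); rewrite e0 rmorph0.
- exact: subst_mx_homog.
- by rewrite subst_mx_comp.
Qed.

End Descent.

(** * Bounded Noether normalisation *)

(** Fibres are bounded through duplicate-free sequences, so no finiteness has to be known
    beforehand. Points are vectors here, not lines. *)
Definition fibres_le (V W : choiceType) (X : V -> Prop) (f : V -> W) (M : nat) : Prop :=
  forall w (s : seq V), uniq s -> (forall v, v \in s -> X v /\ f v = w) -> (size s <= M)%N.

Lemma fibres_le_comp (V W U : choiceType) (X : V -> Prop) (Y : W -> Prop)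
    (f : V -> W) (g : W -> U) M M' :
  (forall v, X v -> Y (f v)) -> fibres_le X f M -> fibres_le Y g M' ->
  fibres_le X (g \o f) (M' * M).
Proof.
move=> XY hf hg w s us hs; pose u := undup (map f s).
have su : (size u <= M')%N.
  apply: (hg w); first exact: undup_uniq.
  by move=> y; rewrite mem_undup => /mapP[v /hs[/XY Yv e] ->].
apply: leq_trans (leq_mul su (leqnn M)).
have -> : size s = (\sum_(y <- u) size [seq v <- s | f v == y])%N.
  rewrite -sum1_size (eq_big_seq (fun v => \sum_(y <- u) (f v == y : nat)))%N.
    rewrite exchange_big /=; apply: eq_bigr => y _.
    by rewrite size_filter -sum1_count [RHS]big_mkcond; apply: eq_bigr => v _; case: eqP.
  move=> v vs; rewrite (bigD1_seq (f v)) ?undup_uniq ?mem_undup ?map_f //= eqxx.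
  by rewrite big1 // => y; rewrite eq_sym => /negPf->.
rewrite -sum1_size big_distrl /= leq_sum // => y _; rewrite mul1n.
apply: (hf y); first exact: filter_uniq.
by move=> v; rewrite mem_filter => /andP[/eqP e /hs[]].
Qed.

Lemma fibres_le_mono (V W : choiceType) (X X' : V -> Prop) (f f' : V -> W) M M' :
  (forall v, X' v -> X v) -> f =1 f' -> (M <= M')%N -> fibres_le X f M -> fibres_le X' f' M'.
Proof.
move=> XX' ff' MM' h w s us hs; apply: leq_trans MM'; apply: (h w) => // v /hs[/XX' ? <-].
by rewrite ff'.
Qed.

(** A vector is determined by its projection and its coordinate X_0, and the latter is a root of a
    nonzero polynomial of degree at most e. *)
Lemma fibres_le_proj (F : fieldType) (k e : nat) (G : {mpoly F[k.+1]}) (a : 'I_k -> F) :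
  G \is e.-homog -> G.@[proj_centre a] != 0 ->
  fibres_le (fun v : 'rV[F]_k.+1 => G.@[v ord0] = 0) (fun v => v *m proj_mx a) e.
Proof.
move=> homG Ga w s us hs; have [g [g0 sg hg]] := proj_fibre homG Ga w.
rewrite -ltnS; apply: leq_trans sg.
rewrite -(size_map (fun v : 'rV_k.+1 => v ord0 ord0)); apply: max_poly_roots => //.
  by apply/allP => _ /mapP[v /hs[Gv vw] ->]; apply: hg.
rewrite map_inj_in_uniq // => v v' /hs[_ e1] /hs[_ e2]; apply: (@proj_mx_inj _ _ a).
exact: etrans e1 (esym e2).
Qed.

Lemma map_proj_mx (R S : comNzRingType) (f : {rmorphism R -> S}) k (a : 'I_k -> R) :
  map_mx f (proj_mx a) = proj_mx (f \o a).
Proof.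
apply/matrixP => i j; rewrite !mxE; case: unlift => [i'|]; last by rewrite rmorphN.
by rewrite rmorph_nat.
Qed.

Definition entries_le (b m k : nat) (T : 'M[int]_(m, k)) : Prop :=
  forall i j, (`|T i j| <= b)%N.

(** The new columns are the differences T_(j+1) - a_j T_0, bounded by b + c b. *)
Lemma entries_le_proj b c m k (T : 'M[int]_(m, k.+1)) (a : 'I_k -> nat) :
  entries_le b T -> (forall i, (a i <= c)%N) ->
  entries_le (b * c.+1) (T *m proj_mx (fun i => (a i)%:Z)).
Proof.
move=> hT ha i j.
have -> : (T *m proj_mx (fun i => (a i)%:Z)) i j = T i (lift ord0 j) - (a j)%:Z * T i ord0.
  have := mul_proj_mx (fun i => (a i)%:Z) (row i T) j.
  by rewrite -row_mul !mxE.
have := leq_mul (ha j) (hT i ord0); rewrite mulnS => h.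
rewrite -lez_nat abszE (le_trans (ler_normB _ _)) // PoszD lerD //.
  by rewrite -abszE lez_nat.
by rewrite normrM -!abszE -PoszM lez_nat absz_nat [(b * c)%N]mulnC.
Qed.

Definition int_mx (m k : nat) (T : 'M[int]_(m, k)) : 'M[K]_(m, k) := map_mx intr T.

Section BoundedDescent.
Variables (N r d : nat) (Z : variety N).
Hypotheses (intZ : geom_integral Z) (asymp : hilbert_asymp Z r d) (d0 : (0 < d)%N).

Definition cone (v : 'rV[K]_N.+1) : Prop := forall p, p \in Z -> p.@[v ord0] = 0.

(** The number of generators is bounded along with the fibres because it will bound the coefficients
    of the linear form added in [primitive_form]. *)
Definition finite_projection (k b M : nat) (T : 'M[int]_(N.+1, k)) : Prop :=
  [/\ entries_le b T, fibres_le cone (fun v => v *m int_mx T) M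
    & exists (J : finType) (t : J -> {mpoly K[N.+1]}) (e : J -> nat),
      [/\ (#|J| <= M)%N, forall j, t j \is (e j).-homog & generates Z (int_mx T) t]].

Lemma cone_subst k (T : 'M[K]_(N.+1, k)) p v :
  subst_mx T p \in Z -> cone v -> p.@[(v *m T) ord0] = 0.
Proof. by move=> pZ cv; rewrite -meval_subst_mx; apply: cv. Qed.

(** [small_relation] supplies a form of degree at most d, so a centre off it can be chosen with
    coordinates at most d. *)
Lemma finite_projection_step k b M (T : 'M[int]_(N.+1, k.+2)) :
  (r <= k)%N -> finite_projection b M T ->
  exists T' : 'M[int]_(N.+1, k.+1), finite_projection (b * d.+1) (d * M) T'.
Proof.
move=> rk [bT fT [J [t [e [JM homt gen]]]]].
have [c [F [cd F0 homF FZ]]] := small_relation intZ asymp d0 (rk : (r < k.+1)%N) homt gen.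
have [a ac Fa] := proj_centre_exists homF (@char_zero_num _) F0.
have mapP : int_mx (proj_mx (fun i => (a i)%:Z)) = proj_mx (fun i => (a i)%:R).
  by rewrite /int_mx map_proj_mx.
exists (T *m proj_mx (fun i => (a i)%:Z)); split.
- apply: entries_le_proj => // i; exact: leq_trans (ac i) cd.
- apply: (fibres_le_mono (X := cone) _ _ (leq_mul cd (leqnn M)) (fibres_le_comp _ fT (fibres_le_proj homF Fa))) => // v.
    by rewrite /= /int_mx map_mxM -/(int_mx _) -/(int_mx _) mapP mulmxA.
  exact: cone_subst.
exists (J * 'I_c)%type, (fun js : J * 'I_c => t js.1 * subst_mx (int_mx T) 'X_ord0 ^+ js.2), (fun js : J * 'I_c => e js.1 + js.2)%N.
split.
- by rewrite card_prod card_ord mulnC leq_mul.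
- move=> js; apply: dhomogM => //; rewrite -[X in _ \is X.-homog]mul1n; apply: dhomogMn.
  by apply: subst_mx_homog; rewrite dhomogX; apply/eqP/mdeg1.
by rewrite /int_mx map_mxM -/(int_mx _) -/(int_mx _) mapP; apply: generates_proj homF FZ Fa gen.
Qed.

Lemma dim_le_ambient : (r <= N)%N.
Proof.
rewrite leqNgt; apply/negP => Nr; case: asymp => P [m0 [sP cP hP]].
have : P`_r <= (binomial_poly N)`_r.
  apply: (@poly_le_coef _ _ _ m0); rewrite ?sP ?size_binomial_poly ?(leq_trans Nr) // => m /hP->.
  by rewrite horner_binomial_poly ler_nat -(hilbert_funE Z m) leq_addr.
rewrite cP [X in _ <= X]nth_default ?size_binomial_poly // leNgt => /negP; apply.
by rewrite divr_gt0 ?ltr0n ?fact_gt0.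
Qed.

Lemma bounded_noether : exists T : 'M[int]_(N.+1, r.+1),
  finite_projection (d.+1 ^ N) (d ^ N) T.
Proof.
(* j counts the projections already made, starting from the identity. The final exponents are raised
   from N - r to N. *)
suff H j k : (k + j = N)%N -> (r <= k)%N -> exists T : 'M[int]_(N.+1, k.+1),
    finite_projection (d.+1 ^ j) (d ^ j) T.
  have [T [bT fT [J [t [e [JM homt gen]]]]]] := H (N - r)%N r (subnKC dim_le_ambient) (leqnn r).
  have dNr : (d ^ (N - r) <= d ^ N)%N by rewrite leq_pexp2l // leq_subr.
  exists T; split.
  - by move=> i j; apply: leq_trans (bT i j) _; rewrite leq_pexp2l // leq_subr.
  - exact: (fibres_le_mono _ _ dNr fT).
  - by exists J, t, e; split=> //; apply: leq_trans JM dNr.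
elim: j k => [|j IH] k.
  rewrite addn0 => -> _; exists 1%:M; split.
  - by move=> i j; rewrite mxE; case: eqP.
  - move=> w s us hs; case: s us hs => // v [|v' s] //= /andP[]; rewrite inE negb_or => /andP[vv' _] _ hs.
    case/eqP: vv'; have [_] := hs v (mem_head _ _); have [|_] := hs v'; first by rewrite !inE eqxx orbT.
    by rewrite /int_mx map_mx1 !mulmx1 => -> ->.
  exists unit, (fun=> 1), (fun=> 0%N); split=> //; first by rewrite card_unit.
    by move=> _; apply: dhomog1.
  move=> p; exists (fun=> p); rewrite big_const card_unit /= addr0 mulr1 /int_mx map_mx1.
  by rewrite subst_mx1 subrr variety0.
move=> kj rk; have [T hT] := IH k.+1 (etrans (addSnnS _ _) kj) (leqW rk).
have [T' hT'] := finite_projection_step rk hT.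
by exists T'; rewrite expnSr expnS.
Qed.

End BoundedDescent.

(** * Birational projections *)

Section CoordinateRing.
Variables (N : nat) (Z : variety N).
Hypothesis (intZ : geom_integral Z).

Definition ideal_pred : {mpoly K[N.+1]} -> bool := fun p => p \in Z.

Fact ideal_pred_idealr : idealr_closed ideal_pred.
Proof.
split; first exact: variety0.
  exact: (variety1 intZ).
by move=> a u v uZ vZ; apply: variety_lin.
Qed.

HB.instance Definition _ := isIdealr.Build {mpoly K[N.+1]} ideal_pred ideal_pred_idealr.
HB.instance Definition _ :=
  isPrimeIdealrClosed.Build {mpoly K[N.+1]} ideal_pred intZ.1.

Definition coord_ideal : prime_idealr {mpoly K[N.+1]} := [the prime_idealr {mpoly K[N.+1]} of ideal_pred].
Definition coord_ring : Type := {ideal_quot coord_ideal}.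
HB.instance Definition _ := GRing.ComNzRing.on coord_ring.

(** The quotient is needed as an [idomainType], which carries a unit predicate and an inverse; both
    are obtained classically. *)
Definition coord_unit (x : coord_ring) : bool := `[< exists y, y * x = 1 >].
Definition coord_inv (x : coord_ring) : coord_ring :=
  if pselect (exists y, y * x = 1) is left h then projT1 (cid h) else x.

Fact coord_mulVx : {in coord_unit, left_inverse 1 coord_inv *%R}.
Proof.
move=> x /asboolP xU; rewrite /coord_inv; case: pselect => // h.
by case: (cid h).
Qed.

Fact coord_unitP x y : y * x = 1 -> coord_unit x.
Proof. by move=> e; apply/asboolP; exists y. Qed.

Fact coord_inv_out : {in [predC coord_unit], coord_inv =1 id}.
Proof. by move=> x /asboolP xU; rewrite /coord_inv; case: pselect. Qed.

HB.instance Definition _ := GRing.ComNzRing_hasMulInverse.Build coord_ring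
  coord_mulVx coord_unitP coord_inv_out.

Fact coord_integral (x y : coord_ring) : x * y = 0 -> (x == 0) || (y == 0).
Proof. exact: Quotient.rquot_IdomainAxiom. Qed.

HB.instance Definition _ := GRing.ComUnitRing_isIntegral.Build coord_ring coord_integral.

Definition to_coord (p : {mpoly K[N.+1]}) : coord_ring := \pi_({ideal_quot coord_ideal})%qT p.

Fact to_coord_additive : additive to_coord.
Proof. by move=> p q; rewrite /to_coord !piE. Qed.

Fact to_coord_multiplicative : multiplicative to_coord.
Proof. by split=> [p q|]; rewrite /to_coord !piE. Qed.

HB.instance Definition _ :=
  GRing.isAdditive.Build {mpoly K[N.+1]} coord_ring to_coord to_coord_additive.
HB.instance Definition _ :=
  GRing.isMultiplicative.Build {mpoly K[N.+1]} coord_ring to_coord to_coord_multiplicative.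

(** Hides the construction: later arguments use only a domain and a morphism whose kernel is the
    ideal. *)
Lemma coord_ring_exists : exists (A : idomainType) (phi : {rmorphism {mpoly K[N.+1]} -> A}),
  forall p, (phi p == 0) = (p \in Z).
Proof.
exists coord_ring, to_coord => p.
rewrite /= /to_coord -[0](rmorph0 to_coord) /to_coord.
by rewrite -(Quotient.idealrBE coord_ideal) subr0.
Qed.

End CoordinateRing.

Lemma mderiv_horner (R : comNzRingType) n (j : 'I_n) (p : {poly {mpoly R[n]}}) x :
  mderiv j p.[x] = (map_poly (mderiv j) p).[x] + p^`().[x] * mderiv j x.
Proof.
elim/poly_ind: p => [|p c IH].
  by rewrite !raddf0 horner0 mul0r addr0 mderiv0.
rewrite hornerD hornerM hornerX hornerC mderivD mderivM IH.
have -> : map_poly (mderiv j) (p * 'X + c%:P) = map_poly (mderiv j) p * 'X + (mderiv j c)%:P.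
  apply/polyP => i.
  rewrite (coef_map (mderiv j)).
  rewrite [in RHS]coefD [in RHS]coefMX [in RHS]coefC (coef_map (mderiv j)).
  rewrite [in LHS]coefD [in LHS]coefMX [in LHS]coefC /=.
  by case: i => [|i] /=; rewrite raddfD ?raddf0.
rewrite derivD derivM derivX derivC addr0 mulr1 !hornerE; ring.
Qed.

Lemma map_mpoly_mderiv (R S : comNzRingType) (f : {rmorphism R -> S}) n (j : 'I_n) (p : {mpoly R[n]}) :
  mderiv j (map_mpoly f p) = map_mpoly f (mderiv j p).
Proof.
apply/mpolyP => m; rewrite mcoeff_map_mpoly !mcoeff_mderiv mcoeff_map_mpoly.
by rewrite raddfMn.
Qed.

Lemma msize_map_mpoly_le (R S : nzRingType) (f : {rmorphism R -> S}) n (p : {mpoly R[n]}) :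
  (msize (map_mpoly f p) <= msize p)%N.
Proof.
rewrite msizeE; apply/bigmax_leqP_seq => m mp _; apply: msize_mdeg_lt.
move: mp; rewrite !mcoeff_msupp mcoeff_map_mpoly; apply: contra => /eqP->.
by rewrite raddf0.
Qed.

Lemma msize_horner_tdeg (R S : comNzRingType) (f : {rmorphism R -> S}) n D
    (p : {poly {mpoly R[n]}}) (x : {mpoly S[n]}) :
  tdeg_le D p -> (msize x <= 2)%N ->
  (msize (map_poly (map_mpoly f) p).[x] <= D.+1)%N.
Proof.
move=> hp hx; have msx i : (msize (x ^+ i) <= i.+1)%N.
  elim: i => [|i IH]; first by rewrite expr0 msize1.
  rewrite exprS (leq_trans (msizeM_leq _ _)) //.
  by move: (msize x) (msize (x ^+ i)) hx IH => a b; lia.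
rewrite horner_coef (leq_trans (msize_sum _ _ _)) //; apply/bigmax_leqP => i _.
rewrite coef_map /=; have := hp i; have := msize_map_mpoly_le f p`_i; have := msx i.
have [->|c0] := eqVneq (map_mpoly f p`_i) 0; first by rewrite mul0r msize0.
move=> h1 h2 h3; apply: leq_trans (msizeM_leq _ _) _.
have : (0 < msize (map_mpoly f p`_i))%N by rewrite lt0n msize_poly_eq0.
move: (msize (map_mpoly _ _)) (msize (x ^+ i)) (msize p`_i) h1 h2 h3 => a b c; lia.
Qed.

Lemma tdeg_le_prod (R : nzRingType) n (I : finType) (F : I -> {poly {mpoly R[n]}}) :
  (forall i, tdeg_le 1 (F i)) -> tdeg_le #|I| (\prod_i F i).
Proof.
move=> hF; rewrite -sum1_card.
apply: (big_ind2 (fun f e => tdeg_le e f)) => //; first exact: tdeg_le1.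
by move=> *; apply: tdeg_leM.
Qed.

Lemma tdeg_le_det (R : comNzRingType) n m (B : 'M[{poly {mpoly R[n]}}]_m) :
  (forall i j, tdeg_le 1 (B i j)) -> tdeg_le m (\det B).
Proof.
move=> hB; apply: tdeg_le_sum => s _; rewrite mulr_sign.
case: ifP => _; [apply: tdeg_leN|]; rewrite -[X in tdeg_le X](card_ord m);
  exact: tdeg_le_prod.
Qed.

Lemma derivn_monic_top (R : nzRingType) (p : {poly R}) m : p \is monic -> size p = m.+1 ->
  p^`(m) = m`!%:R%:P.
Proof.
move=> /monicP lp sp; apply/polyP => i; rewrite coef_derivn coefC.
case: i => [|i]; last by rewrite nth_default ?mul0rn // sp addnS ltnS leq_addr.
by rewrite addn0 ffactnn; move: lp; rewrite lead_coefE sp /= => ->.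
Qed.

(** The new linear form is column 0, so that projecting from [1 : 0 : ... : 0] forgets it and
    recovers T. *)
Definition add_form (m k : nat) (c : 'I_m -> nat) (T : 'M[K]_(m, k)) : 'M[K]_(m, k.+1) :=
  \matrix_(i, j) if unlift ord0 j is Some j' then T i j' else (c i)%:R.

Lemma add_form_proj m k c (T : 'M[K]_(m, k)) :
  add_form c T *m proj_mx (fun=> 0) = T.
Proof.
apply/matrixP => i j; have := mul_proj_mx (fun=> 0) (row i (add_form c T)) j.
by rewrite -row_mul mxE => ->; rewrite !mxE liftK mul0r subr0.
Qed.

Lemma subst_add_form0 m k c (T : 'M[K]_(m, k)) :
  subst_mx (add_form c T) 'X_ord0 = \sum_i (c i)%:R *: 'X_i.
Proof.
rewrite subst_mxX; apply: eq_bigr => i _.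
by rewrite mxE unlift_none.
Qed.

Section PrimitiveForm.
Variables (N k : nat) (Z : variety N).
Variables (T : 'M[K]_(N.+1, k)) (J : finType) (t : J -> {mpoly K[N.+1]}).
Hypotheses (intZ : geom_integral Z) (gen : generates Z T t).
Variables (A : idomainType) (phi : {rmorphism {mpoly K[N.+1]} -> A}).
Hypothesis phiZ : forall p, (phi p == 0) = (p \in Z).

Local Notation W := {mpoly K[k]}.
Local Notation psi := (phi \o subst_mx T).

Lemma coord_char_zero : char_zero A.
Proof.
move=> m /eqP; rewrite -(rmorph_nat phi) phiZ -mpolyC_nat => /(variety_const intZ)/eqP.
by rewrite pnatr_eq0 => /eqP.
Qed.

(** The first ['X_l] is a coordinate, sent to A; the second is the indeterminate coefficient c_l. *)
Definition generic_form : {mpoly A[N.+1]} := \sum_l phi 'X_l *: 'X_l.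

(** Sends ['X] to the generic linear form and the coefficients from W to A, keeping the
    indeterminates c. *)
Definition eval_generic : {poly {mpoly W[N.+1]}} -> {mpoly A[N.+1]} :=
  horner_eval generic_form \o map_poly (map_mpoly psi).

HB.instance Definition _ := GRing.RMorphism.on eval_generic.

Lemma eval_genericC w : eval_generic w%:P = map_mpoly psi w.
Proof. by rewrite /eval_generic /= map_polyC /horner_eval hornerC. Qed.

Lemma eval_genericX : eval_generic 'X = generic_form.
Proof. by rewrite /eval_generic /= map_polyX /horner_eval hornerX. Qed.

Lemma msize_generic_form : (msize generic_form <= 2)%N.
Proof.
rewrite (leq_trans (msize_sum _ _ _)) //; apply/bigmax_leqP => l _.
by rewrite (leq_trans (msizeZ_le _ _)) // msizeX mdeg1.
Qed.

Lemma coord_generator_neq0 : exists j, phi (t j) != 0.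
Proof.
apply: contrapT => nex; have [q hq] := gen 1.
case/negP: (variety1 intZ); rewrite -[1](subrK (\sum_j subst_mx T (q j) * t j)).
apply: variety_add => //; apply: variety_sum => j _; apply: variety_mul.
by rewrite -phiZ; apply: contraT => h; case: nex; exists j.
Qed.

(* Multiplication by the generic linear form, written on the generators t_j,
   is a matrix whose characteristic polynomial annihilates that form. *)
Lemma generic_char_poly : exists chi : {poly {mpoly W[N.+1]}},
  [/\ chi \is monic, size chi = #|J|.+1, tdeg_le #|J| chi & eval_generic chi = 0].
Proof.
have /choice[beta hbeta] : forall li : 'I_N.+1 * J, exists q : J -> W,
    'X_(li.1) * t li.2 - \sum_j subst_mx T (q j) * t j \in Z.
  by move=> li; apply: gen.
(* The entries are linear in the indeterminates c, whence the total degree of the characteristic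
   polynomial is at most #|J|. *)
pose B : 'M[{mpoly W[N.+1]}]_#|J| :=
  \matrix_(i, j) \sum_l beta (l, enum_val i) (enum_val j) *: 'X_l.
exists (char_poly B); split; [exact: char_poly_monic|exact: size_char_poly| |].
  apply: tdeg_le_det => i j; rewrite !mxE; apply: tdeg_leD.
    by case: eqP => _; rewrite ?mulr1n ?mulr0n; [exact: tdeg_leX | exact: tdeg_le0].
  apply: tdeg_leN; apply: tdeg_leC; rewrite (leq_trans (msize_sum _ _ _)) //.
  apply/bigmax_leqP => l _.
  by rewrite (leq_trans (msizeZ_le _ _)) // msizeX mdeg1.
rewrite /char_poly -det_map_mx; set Q := map_mx _ _.
pose tau : 'cV[{mpoly A[N.+1]}]_#|J| := \col_i (phi (t (enum_val i)))%:MP.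
have Qtau : Q *m tau = 0.
  apply/colP => i; rewrite !mxE.
  transitivity (\sum_j (generic_form *+ (i == j) - \sum_l psi (beta (l, enum_val i) (enum_val j)) *: 'X_l) * (phi (t (enum_val j)))%:MP).
    apply: eq_bigr => j _; rewrite !mxE rmorphB rmorphMn /= eval_genericC eval_genericX rmorph_sum.
    by congr ((_ - _) * _); apply: eq_bigr => l _; rewrite /= map_mpolyZ map_mpolyX.
  under eq_bigr => j _ do rewrite mulrBl.
  rewrite sumrB (bigD1 i) //= eqxx mulr1n big1 ?addr0 => [|j ji]; last first.
    by rewrite eq_sym (negPf ji) mulr0n mul0r.
  apply/eqP; rewrite subr_eq0; apply/eqP.
  under [RHS]eq_bigr => j _ do rewrite mulr_suml.
  rewrite exchange_big /generic_form mulr_suml /=; apply: eq_bigr => l _.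
  have := hbeta (l, enum_val i); rewrite -phiZ rmorphB rmorphM rmorph_sum subr_eq0 /= => /eqP e.
  rewrite -scalerAl [X in _ *: X]mulrC mul_mpolyC scalerA e scaler_suml.
  rewrite (big_enum_val (fun j => (phi (subst_mx T (beta (l, enum_val i) j) * t j)) *: 'X_l)) /=.
  apply: eq_bigr => j _.
  by rewrite rmorphM -scalerAl [_ * _%:MP]mulrC mul_mpolyC scalerA mulrC.
(* The adjugate turns Q tau = 0 into det Q * tau = 0, and a nonzero entry of tau can be cancelled in
   a domain. *)
have [j tj] := coord_generator_neq0.
have := congr1 (fun v : 'cV_#|J| => v (enum_rank j) ord0) (congr1 (mulmx (\adj Q)) Qtau).
rewrite mulmxA mul_adj_mx mulmx0 mul_scalar_mx !mxE enum_rankK => /eqP.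
by rewrite mulf_eq0 mpolyC_eq0 (negPf tj) orbF => /eqP.
Qed.

(** The chain rule; the derivative of the generic form with respect to c_i is the coordinate X_i. *)
Lemma eval_generic_deriv i f :
  mderiv i (eval_generic f) =
  eval_generic (map_poly (mderiv i) f) + eval_generic f^`() * (phi 'X_i)%:MP.
Proof.
rewrite /eval_generic /= /horner_eval mderiv_horner deriv_map; congr (_.[_] + _ * _).
  apply/polyP => u; rewrite !coef_map /=.
  by rewrite map_mpoly_mderiv.
rewrite /generic_form raddf_sum (bigD1 i) //= mderivZ mderivX mnm1E eqxx scale1r.
rewrite (_ : (_ - _)%MM = 0%MM) ?mpolyX0; last by apply/mnmP => u; rewrite mnmBE subnn mnm0E.
rewrite big1 ?addr0 => [|j ji]; first by rewrite -mul_mpolyC mulr1.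
by rewrite mderivZ mderivX mnm1E (negPf ji) scale0r scaler0.
Qed.

(** The derivative of chi may vanish at the generic form too, so f is the iterated derivative just
    before the first that does not vanish there. One exists, since the derivative of order #|J| is
    the constant #|J|!, nonzero in characteristic 0. *)
Lemma separable_relation : exists f : {poly {mpoly W[N.+1]}},
  [/\ tdeg_le #|J| f, eval_generic f = 0 & eval_generic f^`() != 0].
Proof.
have [chi [mchi schi dchi chi0]] := generic_char_poly.
have ex : exists s, eval_generic chi^`(s) != 0.
  exists #|J|; rewrite (derivn_monic_top mchi schi) polyC_natr rmorph_nat.
  rewrite -mpolyC_nat mpolyC_eq0; apply/eqP => /coord_char_zero/eqP.
  by rewrite -leqn0 leqNgt fact_gt0.
case: (ex_minnP ex) => -[|s] hs smin; first by rewrite chi0 eqxx in hs.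
exists chi^`(s); split; first exact: tdeg_le_derivn.
  by apply: contraTeq (ltnSn s) => /smin; rewrite ltnNge => ->.
by rewrite -derivnS.
Qed.

(** Puts integers for the indeterminates c and turns ['X] into the variable X_0, which [add_form]
    maps to the specialised linear form. *)
Definition specialise (c : 'I_N.+1 -> nat) (f : {poly {mpoly W[N.+1]}}) : {mpoly K[k.+1]} :=
  of_poly (fun=> 0) (map_poly (meval (fun i => (c i)%:R)) f).

Lemma phi_specialise c f :
  phi (subst_mx (add_form c T) (specialise c f)) = (eval_generic f).@[fun i => (c i)%:R].
Proof.
elim/poly_ind: f => [|f w IH].
  rewrite (_ : specialise c 0 = 0); last by rewrite /specialise map_poly0 rmorph0.
  by rewrite (rmorph0 eval_generic) meval0 !rmorph0.
have sM g h : specialise c (g * h) = specialise c g * specialise c h by rewrite /specialise !rmorphM.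
have sD g h : specialise c (g + h) = specialise c g + specialise c h by rewrite /specialise !rmorphD.
rewrite sD sM !(rmorphD, rmorphM) /= -IH eval_genericX eval_genericC; congr (_ * _ + _).
  rewrite /specialise map_polyX of_polyX subst_add_form0 /generic_form !raddf_sum /=.
  apply: eq_bigr => l _; rewrite -mul_mpolyC rmorphM mevalZ mevalXU mulrC; congr (_ * _).
  by rewrite mpolyC_nat rmorph_nat.
rewrite /specialise map_polyC of_polyC subst_mx_comp add_form_proj /=.
apply: (@mpoly_rmorph_ext _ _ _ (phi \o subst_mx T \o meval (fun i => (c i)%:R))
   (meval (fun i => (c i)%:R) \o map_mpoly psi)) => [u|l] /=.
  by rewrite mevalC map_mpolyC mevalC.
by rewrite mevalXU map_mpolyX mevalXU !rmorph_nat.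
Qed.

(** The element a is a common denominator of the coordinates over the subring generated by the
    linear forms, so that subring and A have the same fraction field. *)
Lemma primitive_form : exists2 c : 'I_N.+1 -> nat, (forall i, (c i <= #|J|)%N)
  & exists2 a, phi (subst_mx (add_form c T) a) != 0
    & forall i, exists q, phi (subst_mx (add_form c T) a * 'X_i) = phi (subst_mx (add_form c T) q).
Proof.
have [f [df f0 f'0]] := separable_relation.
(* The value of f' at the generic form has degree at most #|J| in c, whence the bound on the
   integers chosen. *)
have [|c cJ fc] := mpoly_nonzero_eval coord_char_zero f'0 (_ : (_ <= #|J|.+1)%N).
  apply: msize_horner_tdeg msize_generic_form; exact: (tdeg_le_derivn 1 df).
exists c => //; exists (specialise c f^`()); first by rewrite phi_specialise.
move=> i; set f' := - map_poly (mderiv i) f; exists (specialise c f').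
have e1 := phi_specialise c f^`(); have e2 := phi_specialise c f'.
apply: etrans (rmorphM phi _ _) _; rewrite e1 e2 /f' {e1 e2 f'}.
have := eval_generic_deriv i f; rewrite f0 mderiv0 => /esym/eqP.
rewrite addrC addr_eq0 -rmorphN => /eqP <-.
by rewrite mevalM mevalC.
Qed.

End PrimitiveForm.

Section Birational.
Variables (N r d : nat) (Z : variety N).
Hypotheses (intZ : geom_integral Z) (asymp : hilbert_asymp Z r d) (d0 : (0 < d)%N).

(** With D bounding the degrees of the finitely many generators t j, the power a^D provides one
    factor a for each variable of each of their monomials. The coefficients over T already lie in
    the subring of U. *)
Lemma birational_denominator k (T : 'M[K]_(N.+1, k)) (J : finType) (t : J -> {mpoly K[N.+1]})
    (U : 'M[K]_(N.+1, k.+1)) (P : 'M[K]_(k.+1, k)) a :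
  generates Z T t -> U *m P = T -> subst_mx U a \notin Z ->
  (forall i, exists q, subst_mx U a * 'X_i - subst_mx U q \in Z) ->
  exists2 a', a' \notin Z & forall p, exists q, a' * p - subst_mx U q \in Z.
Proof.
move=> gen UP aZ aX; pose D := (\max_j msize (t j))%N.
exists (subst_mx U a ^+ D).
  elim: D => [|D IH]; first by rewrite expr0; apply: variety1.
  by rewrite exprS; apply/negP => /(variety_prime intZ)[]; apply/negP.
pose inR p := exists q, p - subst_mx U q \in Z.
have inRU q : inR (subst_mx U q) by exists q; rewrite subrr variety0.
have inRZ p p' : p - p' \in Z -> inR p' -> inR p.
  by move=> h [q hq]; exists q; rewrite -(subrK p' p) -addrA; apply: variety_add.
have inRD p p' : inR p -> inR p' -> inR (p + p').
  move=> [q hq] [q' hq']; exists (q + q'); rewrite rmorphD opprD addrACA.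
  exact: variety_add.
have inRM p p' : inR p -> inR p' -> inR (p * p').
  move=> [q hq] [q' hq']; exists (q * q'); rewrite rmorphM.
  have -> : p * p' - subst_mx U q * subst_mx U q' = p' * (p - subst_mx U q) + subst_mx U q * (p' - subst_mx U q').
    by ring.
  by apply: variety_add; apply: variety_mul.
have inR_sum (I : Type) (s : seq I) (Q : pred I) (F : I -> {mpoly K[N.+1]}) :
    (forall i, Q i -> inR (F i)) -> inR (\sum_(i <- s | Q i) F i).
  by move=> h; apply: (big_ind inR) => //; exists 0; rewrite rmorph0 subr0 variety0.
have inR1 : inR 1 by rewrite -(rmorph1 (subst_mx U)); apply: inRU.
have inRX p m : inR p -> inR (p ^+ m).
  by move=> hp; elim: m => [|m IH]; rewrite ?expr0 // exprS; apply: inRM.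
move=> p; change (inR (subst_mx U a ^+ D * p)); have [q hq] := gen p.
apply: (@inRZ _ (subst_mx U a ^+ D * \sum_j subst_mx T (q j) * t j)).
  by rewrite -mulrBr; apply: variety_mul.
rewrite mulr_sumr; apply: (inR_sum) => j _.
rewrite mulrCA; apply: (inRM); first by rewrite -UP -subst_mx_comp.
rewrite (mpolyE (t j)) mulr_sumr big_seq; apply: (inR_sum) => m mt.
rewrite -mul_mpolyC mulrCA; apply: (inRM); first by rewrite -(subst_mxC U).
have mD : (mdeg m <= D)%N.
  by apply: leq_trans (leq_bigmax j); apply: ltnW; apply: msize_mdeg_lt.
rewrite -(subnK mD) exprD -mulrA; apply: (inRM); first exact: inRX.
rewrite mdegE mpolyXE_id -prodrXr -big_split /=.
apply: (big_ind inR) => // i _; rewrite -exprMn; apply: (inRX); exact: aX.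
Qed.

Lemma generates_extend k (T : 'M[K]_(N.+1, k)) (J : finType) (t : J -> {mpoly K[N.+1]})
    l (U : 'M[K]_(N.+1, l)) (P : 'M[K]_(l, k)) :
  U *m P = T -> generates Z T t -> generates Z U t.
Proof.
move=> UP gen p; have [q hq] := gen p; exists (fun j => subst_mx P (q j)).
by under eq_bigr => j _ do rewrite subst_mx_comp UP.
Qed.

(** The degree is exactly d: at most d because the image ring embeds in the coordinate ring, at
    least d because the projection is birational. The new column of U is bounded by #|J|, hence by
    M. *)
Lemma birational_hypersurface b M (T : 'M[int]_(N.+1, r.+1)) :
  finite_projection Z b M T ->
  exists (U : 'M[int]_(N.+1, r.+2)) (F : {mpoly K[r.+2]}),
    [/\ entries_le (maxn b M) U, fibres_le (cone Z) (fun v => v *m int_mx U) M,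
        F \is d.-homog, irreducible_elt F & subst_mx (int_mx U) F \in Z].
Proof.
move=> [bT fT [J [t [e [JM homt gen]]]]].
have [A [phi phiZ]] := coord_ring_exists intZ.
have [c cJ [a aZ aX]] := primitive_form intZ gen phiZ.
pose U : 'M[int]_(N.+1, r.+2) :=
  \matrix_(i, j) if unlift ord0 j is Some j' then T i j' else (c i)%:Z.
have UE : int_mx U = add_form c (int_mx T).
  by apply/matrixP => i j; rewrite !mxE; case: unlift => [j'|//]; rewrite mxE.
have UP : int_mx U *m proj_mx (fun=> 0) = int_mx T by rewrite UE add_form_proj.
have genU := generates_extend UP gen.
have [D [F [homF irrF FZ hD]]] := relations_principal intZ asymp d0 homt genU.
have [||a' a'Z ha'] := @birational_denominator _ _ _ _ (int_mx U) _ a gen UP.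
- by rewrite UE -phiZ.
- by move=> i; have [q hq] := aX i; exists q; rewrite UE -phiZ rmorphB hq subrr.
have DE : D = d.
  apply/eqP; rewrite eqn_leq (hypersurface_degree_le asymp hD).
  exact: (hypersurface_degree_ge intZ asymp hD a'Z ha').
exists U, F; split=> //.
- move=> i j; rewrite mxE leq_max; case: unlift => [j'|]; first by rewrite bT.
  by rewrite absz_nat (leq_trans (cJ i) JM) orbT.
- move=> w s us hs; apply: (fT (w *m proj_mx (fun=> 0)) s us) => v /hs[cv <-].
  by split=> //; rewrite -mulmxA UP.
- by rewrite -DE.
- by apply/FZ; exists 1; rewrite mul1r.
Qed.

End Birational.

(** * Forms not defined over the rationals *)

Definition vanishes_at_int (R : nzRingType) (m : nat) (F : {mpoly R[m]}) (x : 'rV[int]_m) : Prop :=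
  F.@[fun i => (x ord0 i)%:~R] = 0.

Lemma same_degree_divides (F0 : fieldType) m d (F G : {mpoly F0[m]}) :
  F \is d.-homog -> G \is d.-homog -> F != 0 -> divides F G -> exists c, G = c *: F.
Proof.
move=> hF hG nF [u e]; exists u@_0.
have [G0|G0] := eqVneq G 0.
  move: e; rewrite G0 => /esym/eqP; rewrite mulf_eq0 (negPf nF) orbF => /eqP->.
  by rewrite mcoeff0 scale0r.
have [u0|u0] := eqVneq u 0; first by rewrite e u0 mul0r eqxx in G0.
have /(dhomog_uniq nF hF) hF' := dhomog_msize hF.
have /(dhomog_uniq G0 hG) hG' := dhomog_msize hG.
have su : (msize u <= 1)%N.
  have : (0 < msize F)%N by rewrite lt0n msize_poly_eq0.
  have : (0 < msize G)%N by rewrite lt0n msize_poly_eq0.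
  have : msize G = (msize u + msize F).-1 by rewrite e msizeM.
  move: hF' hG'; rewrite /=; move: (msize F) (msize G) (msize u) => x y z; lia.
by rewrite e {1}(msize1_polyC su) mul_mpolyC.
Qed.

(* G is obtained by applying to the coefficients of F a Q-linear map that kills 1
   but not the given irrational coefficient. *)
Lemma irrational_companion m d (F : {mpoly K[m]}) :
  F \is d.-homog -> F != 0 -> mleadc F = 1 -> (exists u, F@_u \notin Crat) ->
  exists G : {mpoly K[m]}, [/\ G \is d.-homog, ~ divides F G
    & forall x, vanishes_at_int F x -> vanishes_at_int G x].
Proof.
move=> homF F0 lF [u Fu].
(* The finitely many coefficients lie in a number field, a finite-dimensional space over the
   rationals in which linear projections exist. *)
have [Qs [QsC [s1 es1 _]]] := num_field_exists [seq F@_v | v <- msupp F].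
have /choice[beta hbeta] : forall v, exists b, QsC b = F@_v.
  move=> v; have [vF|vF] := boolP (v \in msupp F); last first.
    by exists 0; rewrite rmorph0 memN_msupp_eq0.
  have : F@_v \in map QsC s1 by rewrite es1; apply: map_f.
  by case/mapP => b _ ->; exists b.
(* Subtracting a projection onto the line spanned by 1 gives a Q-linear map whose kernel is exactly
   the rationals. *)
pose f (b : Qs) := b - projv <[1]>%VS b.
have f1 : f 1 = 0 by rewrite /f projv_id ?subrr ?memv_line.
have fD b b' : f (b + b') = f b + f b' by rewrite /f linearD /= opprD addrACA.
have fZ (a : rat) b : f (a *: b) = a *: f b by rewrite /f linearZ /= scalerBr.
have fu : f (beta u) != 0.
  apply: contra Fu; rewrite /f subr_eq0 => /eqP e.
  have : beta u \in <[1]>%VS by rewrite e memv_proj.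
  case/vlineP => a ea; rewrite -hbeta ea; apply/CratP; exists a.
  by rewrite alg_num_field fmorph_rat.
have fsum (I : Type) (s : seq I) (g : I -> Qs) : f (\sum_(i <- s) g i) = \sum_(i <- s) f (g i).
  by apply: (big_morph f fD); rewrite /f linear0 subr0.
pose G : {mpoly K[m]} := \sum_(v <- msupp F) QsC (f (beta v)) *: 'X_[v].
have Gc v : G@_v = QsC (f (beta v)).
  rewrite /G raddf_sum /=; have [vF|vF] := boolP (v \in msupp F).
    rewrite (bigD1_seq v) ?msupp_uniq //= mcoeffZ mcoeffX eqxx mulr1 big1 ?addr0 // => w wv.
    by rewrite mcoeffZ mcoeffX (negPf wv) mulr0.
  have -> : beta v = 0.
    by apply: (fmorph_inj QsC); rewrite hbeta rmorph0 memN_msupp_eq0.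
  rewrite (_ : f 0 = 0) ?rmorph0; last by rewrite /f linear0 subr0.
  rewrite big_seq big1 // => w wF; rewrite mcoeffZ mcoeffX.
  by case: eqP => [ew|]; rewrite ?mulr0 //; rewrite -ew wF in vF.
have G0 : G != 0.
  by apply/eqP => e; move: (Gc u); rewrite e mcoeff0 => /esym/eqP; rewrite fmorph_eq0 (negPf fu).
have homG : G \is d.-homog.
  rewrite /G big_seq rpred_sum // => v /(dhomogP _ _ _ homF) vd.
  by rewrite rpredZ // dhomogX; apply/eqP.
(* The degrees agree, so divisibility would mean G = c F. The leading coefficient 1 of F is killed
   by f, which gives c = 0, although G is nonzero. *)
exists G; split=> // [/(same_degree_divides homF homG F0)[c e]|x].
  have bl : beta (mlead F) = 1 by apply: (fmorph_inj QsC); rewrite hbeta lF rmorph1.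
  have := Gc (mlead F); rewrite bl f1 rmorph0 e mcoeffZ lF mulr1 => c0.
  by rewrite e c0 scale0r eqxx in G0.
rewrite /vanishes_at_int.
pose mon (v : 'X_{1..m}) : int := \prod_i x ord0 i ^+ v i.
have monE (v : 'X_{1..m}) : \prod_i (x ord0 i)%:~R ^+ v i = (mon v)%:~R :> K.
  by rewrite rmorph_prod; apply: eq_bigr => i _; rewrite rmorphXn.
rewrite mevalE => Fx.
(* At an integral point the monomials take integer values, so the vanishing of F is a Q-linear
   relation between its coefficients, which f preserves. *)
have {}Fx : \sum_(v <- msupp F) (mon v)%:~R *: beta v = 0 :> Qs.
  apply: (fmorph_inj QsC); rewrite rmorph0 -[RHS]Fx rmorph_sum; apply: eq_bigr => v _ /=.
  by rewrite monE -mulr_algl rmorphM hbeta alg_num_field ratr_int rmorph_int mulrC.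
rewrite /G raddf_sum /=.
transitivity (QsC (f (\sum_(v <- msupp F) (mon v)%:~R *: beta v))).
  rewrite fsum rmorph_sum; apply: eq_bigr => v _.
  by rewrite mevalZ mevalX monE fZ -mulr_algl rmorphM alg_num_field ratr_int rmorph_int mulrC.
by rewrite Fx /f linear0 subr0 rmorph0.
Qed.

Lemma rational_model m d (F : {mpoly K[m]}) :
  F \is d.-homog -> irreducible_elt F -> (forall u, F@_u \in Crat) ->
  exists F' : {mpoly int[m]}, [/\ F' \is d.-homog, abs_irreducible F'
    & forall x, vanishes_at_int F x -> F'.@[x ord0] = 0].
Proof.
move=> homF irrF Frat.
have /choice[q hq] : forall u, exists a : rat, F@_u = ratr a.
  by move=> u; apply/CratP.
pose L : int := \prod_(u <- msupp F) denq (q u).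
have L0 : L != 0 by rewrite prodf_seq_neq0; apply/allP => u _; rewrite denq_neq0.
have /choice[z hz] : forall u, exists z : int, L%:~R * F@_u = z%:~R.
  move=> u; have [uF|uF] := boolP (u \in msupp F); last first.
    by exists 0; rewrite memN_msupp_eq0 // mulr0.
  exists (numq (q u) * \prod_(v <- msupp F | v != u) denq (q v)).
  rewrite /L (bigD1_seq u) ?msupp_uniq //= hq rmorphM [ratr _]/ratr /=.
  rewrite !rmorphM /= mulrAC; congr (_ * _); rewrite mulrCA mulfV ?mulr1 //.
  by rewrite intr_eq0 denq_neq0.
pose F' : {mpoly int[m]} := \sum_(u <- msupp F) z u *: 'X_[u].
have F'E : map_mpoly intr F' = L%:~R *: F.
  rewrite /F' raddf_sum {2}(mpolyE F) scaler_sumr /=; apply: eq_bigr => u _.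
  by rewrite map_mpolyZ map_mpolyX scalerA hz.
exists F'; split.
- rewrite /F' big_seq rpred_sum // => u /(dhomogP _ _ _ homF) ud.
  by rewrite rpredZ // dhomogX; apply/eqP.
- have LK : L%:~R != 0 :> K by rewrite intr_eq0.
  case: irrF => F0 FU FI; rewrite /abs_irreducible F'E; split.
  + by rewrite scaler_eq0 negb_or LK.
  + by move: FU; rewrite !mpoly_unit_msize msizeZ.
  + move=> a b e; have : F = (L%:~R^-1 *: a) * b.
      by rewrite -scalerAl -e scalerA mulVf ?scale1r.
    by case/FI; rewrite !mpoly_unit_msize ?msizeZ ?invr_eq0 //; [left|right].
move=> x Fx; apply/eqP; rewrite -(intr_eq0 K); apply/eqP.
have -> : (F'.@[x ord0])%:~R = (map_mpoly intr F').@[fun i => (x ord0 i)%:~R] :> K.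
  elim/mpolyind: F' {F'E} => [|c u p _ _ IH]; first by rewrite !raddf0.
  rewrite mevalD intrD IH (rmorphD (map_mpoly intr)) mevalD /=; congr (_ + _).
  rewrite map_mpolyZ map_mpolyX !mevalZ !mevalX rmorphM rmorph_prod; congr (_ * _).
  by apply: eq_bigr => i _; rewrite rmorphXn.
by rewrite F'E mevalZ Fx mulr0.
Qed.

(** Dividing by the leading coefficient first makes the two cases visible: rational coefficients
    allow clearing denominators, and an irrational one yields a companion form. *)
Lemma rational_dichotomy m d (F : {mpoly K[m]}) :
  F \is d.-homog -> irreducible_elt F ->
  (exists F' : {mpoly int[m]}, [/\ F' \is d.-homog, abs_irreducible F'
    & forall x, vanishes_at_int F x -> F'.@[x ord0] = 0]) \/
  (exists G : {mpoly K[m]}, [/\ G \is d.-homog, ~ divides F G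
    & forall x, vanishes_at_int F x -> vanishes_at_int G x]).
Proof.
move=> homF irrF; have [F0 FU FI] := irrF; pose c := (mleadc F)^-1.
have c0 : c != 0 by rewrite invr_eq0 mleadc_eq0.
have vanZ x : vanishes_at_int F x -> vanishes_at_int (c *: F) x.
  by rewrite /vanishes_at_int mevalZ => ->; rewrite mulr0.
have homcF : c *: F \is d.-homog by apply: rpredZ.
have [rat|nrat] := pselect (forall u, (c *: F)@_u \in Crat).
  left; have [|F' [? ? hF']] := rational_model homcF _ rat; last by exists F'; split=> // x /vanZ/hF'.
  split; first by rewrite scaler_eq0 negb_or c0.
    by move: FU; rewrite !mpoly_unit_msize msizeZ.
  move=> a b e; have : F = (c^-1 *: a) * b.
    by rewrite -scalerAl -e scalerA mulVf ?scale1r.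
  have c1 : c^-1 != 0 by rewrite invr_eq0.
  by case/FI; rewrite !mpoly_unit_msize ?(msizeZ _ c1); [left|right].
right; have [|||G [homG nG hG]] := irrational_companion homcF.
- by rewrite scaler_eq0 negb_or c0.
- by rewrite mleadZ // mcoeffZ mulVf // mleadc_eq0.
- by have [u hu] := (existsNP _).2 nrat; exists u; apply/negP.
exists G; split=> // [[w e]|x /vanZ/hG //]; apply: nG; exists (c^-1 *: w).
by rewrite -scalerAl -scalerAr scalerA mulVf ?scale1r.
Qed.

(* Since m0 depends only on r and d, the constant of [two_step_projection] is
   uniform in Z. *)
Lemma elimination_degree r d : exists2 m0, (d + d <= m0)%N &
  (second_difference r.+1 d d).[m0%:R] < 'C(m0 + r, r)%:R.
Proof.
apply: contrapT => nex.
have : (binomial_poly r)`_r <= (second_difference r.+1 d d)`_r.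
  apply: (@poly_le_coef _ _ _ (d + d)); rewrite ?size_binomial_poly //.
    exact: leq_trans (size_second_difference _ _ _) (leqnSn _).
  move=> m dm; rewrite horner_binomial_poly leNgt; apply/negP => lt.
  by case: nex; exists m.
rewrite binomial_poly_top [X in _ <= X]nth_default ?size_second_difference // leNgt => /negP; apply.
by rewrite invr_gt0 ltr0n fact_gt0.
Qed.

(** A substitute for the resultant. In degree m0 the space spanned by the multiples of F and G has
    codimension below 'C(m0 + r, r), the dimension of the forms in the r + 1 projected variables, so
    some nonzero one of these pulls back into it. *)
Lemma elimination_form r d m0 (F G : {mpoly K[r.+2]}) (a : 'I_r.+1 -> K) :
  (d + d <= m0)%N -> (second_difference r.+1 d d).[m0%:R] < 'C(m0 + r, r)%:R ->
  F \is d.-homog -> G \is d.-homog -> irreducible_elt F -> ~ divides F G ->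
  exists H : {mpoly K[r.+1]}, [/\ H != 0, H \is m0.-homog
    & forall v : 'rV[K]_r.+2, F.@[v ord0] = 0 -> G.@[v ord0] = 0 ->
      H.@[(v *m proj_mx a) ord0] = 0].
Proof.
move=> dm lt homF homG irrF nFG; have prF := mpoly_irreducible_prime irrF.
have [F0 _ _] := prF.
have G0 : G != 0 by apply: contra_notN nFG => /eqP->; exists 0; rewrite mul0r.
have dm' : (d <= m0)%N := leq_trans (leq_addr _ _) dm.
set X := (limg (mul_form F (m0 - d) m0) + limg (mul_form G (m0 - d) m0))%VS.
have dX := dim_coprime_forms F0 G0 homF homG prF nFG dm.
have XC : (\dim X <= 'C(m0 + r.+1, r.+1))%N.
  by rewrite -(dim_dhomog K); apply: dimvS; apply: subvf.
have ltn : ('C(m0 + r.+1, r.+1) - \dim X < 'C(m0 + r, r))%N.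
  rewrite -(ltr_nat rat); apply: le_lt_trans lt.
  by apply: second_difference_nat.
pose f : 'Hom(dhomog r.+1 K m0, dhomog r.+2 K m0) := linfun (homog_map m0 (subst_mx (proj_mx a))).
have fE p : mpoly_of_dhomog (f p) = subst_mx (proj_mx a) p.
  by rewrite lfunE /= pihomog_dE //; apply/subst_mx_homog/dhomog_is_dhomog.
have := dim_preim f X; rewrite dim_dhomog => dp.
have dpre : (0 < \dim (f @^-1: X))%N.
  have := dimvS (subvf (X + limg f)%VS); rewrite dim_dhomog.
  move: dp ltn XC; move: (\dim X) (\dim (X + limg f)%VS) (\dim (f @^-1: X)%VS) 'C(_, _) 'C(_, _) => *; lia.
pose p := vpick (f @^-1: X)%VS.
have p0 : p != 0 by rewrite vpick0 -dimv_eq0 -lt0n.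
have /memv_addP[_ /memv_imgP[u _ ->] [_ /memv_imgP[w _ ->] e]] : f p \in X.
  by rewrite memv_preim memv_pick.
exists (mpoly_of_dhomog p); split; last move=> v Fv Gv.
- by apply: contra_neq p0 => e0; apply: val_inj.
- exact: dhomog_is_dhomog.
rewrite -meval_subst_mx -fE e [mpoly_of_dhomog _]raddfD /= !mul_formE //.
by rewrite mevalD !mevalM Fv Gv !mul0r addr0.
Qed.

(** The first centre lies off F and gives fibres of at most d points; the second lies off the
    eliminant H, of degree m0, and gives at most m0. *)
Lemma two_step_projection r d m0 (F G : {mpoly K[r.+2]}) :
  (d + d <= m0)%N -> (second_difference r.+1 d d).[m0%:R] < 'C(m0 + r, r)%:R ->
  F \is d.-homog -> G \is d.-homog -> irreducible_elt F -> ~ divides F G ->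
  forall N b (U : 'M[int]_(N.+1, r.+2)), entries_le b U ->
  exists2 T : 'M[int]_(N.+1, r), entries_le (b * d.+1 * m0.+1) T
    & exists P : 'M[int]_(r.+2, r), T = U *m P /\
      fibres_le (fun v : 'rV[K]_r.+2 => F.@[v ord0] = 0 /\ G.@[v ord0] = 0)
                (fun v => v *m int_mx P) (m0 * d).
Proof.
move=> dm lt homF homG irrF nFG N b U bU.
have [F0 _ _] := irrF.
have [a ad Fa] := proj_centre_exists homF (@char_zero_num _) F0.
have [H [H0 homH FGH]] := elimination_form (fun i => (a i)%:R) dm lt homF homG irrF nFG.
have [a' a'm Ha'] := proj_centre_exists homH (@char_zero_num _) H0.
pose P1 : 'M[int]_(r.+2, r.+1) := proj_mx (fun i => (a i)%:Z).
pose P2 : 'M[int]_(r.+1, r) := proj_mx (fun i => (a' i)%:Z).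
have eP1 : int_mx P1 = proj_mx (fun i => (a i)%:R) by rewrite /int_mx map_proj_mx.
have eP2 : int_mx P2 = proj_mx (fun i => (a' i)%:R) by rewrite /int_mx map_proj_mx.
exists (U *m P1 *m P2); first by do 2 apply: entries_le_proj => //.
exists (P1 *m P2); split; first by rewrite mulmxA.
have f1 : fibres_le (fun v : 'rV[K]_r.+2 => F.@[v ord0] = 0 /\ G.@[v ord0] = 0)
    (fun v => v *m proj_mx (fun i => (a i)%:R)) d.
  by move=> w s us hs; apply: (fibres_le_proj homF Fa us) => v /hs[[Fv _] e]; split; [exact: Fv | exact: e].
have f2 := fibres_le_comp (fun (v : 'rV[K]_r.+2) (h : F.@[v ord0] = 0 /\ G.@[v ord0] = 0) => FGH v h.1 h.2) f1 (fibres_le_proj homH Ha').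
apply: (fibres_le_mono _ _ (leqnn _) f2) => // v.
by rewrite /= /int_mx map_mxM -/(int_mx _) -/(int_mx _) eP1 eP2 mulmxA.
Qed.

(** * Counting points *)

Definition content (m : nat) (x : 'rV[int]_m) : nat :=
  \big[gcdn/0%N]_(i < m) `|x ord0 i|%N.

Lemma content_scale m (g : nat) (x : 'rV[int]_m) : content (g%:Z *: x) = (g * content x)%N.
Proof.
rewrite /content (big_morph (muln g) (fun _ _ => muln_gcdr _ _ _) (muln0 g)).
by apply: eq_bigr => i _; rewrite mxE abszM.
Qed.

Lemma primitive_decomp m (z : 'rV[int]_m) : z != 0 ->
  exists (g : nat) (w : 'rV[int]_m), [/\ (0 < g)%N, z = g%:Z *: w & primitive w].
Proof.
move=> z0; have dv i : (content z %| `|z ord0 i|)%N by apply: (biggcdn_inf i).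
have g0 : (0 < content z)%N.
  rewrite lt0n; apply: contra z0 => /eqP g0; apply/eqP/rowP => i; rewrite mxE.
  by have := dv i; rewrite g0 dvd0n absz_eq0 => /eqP.
pose w : 'rV[int]_m := \row_i (z ord0 i %/ content z)%Z.
have zw : z = (content z)%:Z *: w.
  by apply/rowP => i; rewrite !mxE mulrC divzK //; apply: dv.
exists (content z), w; split=> //.
have := content_scale (content z) w; rewrite -zw => e.
by rewrite /primitive -/(content w) -(eqn_pmul2l g0) -e muln1.
Qed.

Lemma height_ge m (x : 'rV[int]_m) i : (`|x ord0 i| <= height x)%N.
Proof. by rewrite /height (bigD1 i) //= leq_maxl. Qed.

Lemma height_le m (x : 'rV[int]_m) b :
  (forall i, (`|x ord0 i| <= b)%N) -> (height x <= b)%N.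
Proof. by move=> h; apply/bigmax_leqP => i _; apply: h. Qed.

Lemma height_mulmx m k b (T : 'M[int]_(m, k)) (x : 'rV[int]_m) :
  entries_le b T -> (height (x *m T) <= m * b * height x)%N.
Proof.
move=> hT; apply: height_le => j; rewrite mxE -lez_nat abszE.
apply: le_trans (ler_norm_sum _ _ _) _.
rewrite (_ : (m * b * height x)%N%:Z = \sum_(i < m) (b * height x)%N%:Z); last first.
  by rewrite sumr_const card_ord -mulnA PoszM -mulr_natl natz.
apply: ler_sum => i _; rewrite normrM -!abszE -PoszM lez_nat mulnC.
by rewrite leq_mul ?hT ?height_ge.
Qed.

Lemma proj_pt_eq N (x x' : 'rV[int]_N.+1) (g g' : nat) : (0 < g)%N -> (0 < g')%N ->
  g'%:Z *: x = g%:Z *: x' -> proj_pt x = proj_pt x'.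
Proof.
have sub (y y' : 'rV[int]_N.+1) (h h' : nat) : (0 < h')%N ->
    h'%:Z *: y = h%:Z *: y' -> (proj_pt y <= proj_pt y')%VS.
  move=> h0 e; rewrite /proj_pt -memvE; apply/vlineP; exists (h%:R / h'%:R).
  have h0' : h'%:R != 0 :> rat by rewrite pnatr_eq0 -lt0n.
  apply: (scalerI h0'); rewrite scalerA mulrCA mulfV // mulr1.
  have := congr1 (map_mx (intr : int -> rat)) e; rewrite !map_mxZ /=.
  by rewrite !pmulrn.
move=> g0 g'0 e; apply/eqP; rewrite eqEsubv (sub _ _ g g') // (sub _ _ g' g) //.
Qed.

Lemma seq_fibres_le (V W : choiceType) (f : V -> W) M (s : seq V) (ws : seq W) :
  uniq s -> (forall v, v \in s -> f v \in ws) ->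
  fibres_le (fun v => v \in s) f M -> (size s <= M * size ws)%N.
Proof.
move=> us hs hf; rewrite mulnC.
have hg : fibres_le (fun w => w \in ws) (fun=> tt) (size ws).
  by move=> u l ul hl; apply: uniq_leq_size => // w /hl[].
have h := @fibres_le_comp _ _ _ (fun v => v \in s) (fun w => w \in ws) f _ _ _ hs hf hg.
by apply: (h tt s us) => v vs.
Qed.

Section CountProjection.
Local Open Scope classical_set_scope.

(** A point x goes to the primitive vector w with x T = g w. Points with the same w give distinct
    vectors x / g in one fibre of T, so at most M of them share it; dividing by g does not increase
    the height. *)
Lemma count_projection (R : realType) N (Z : variety N) k (T : 'M[int]_(N.+1, k)) b M
    (X : 'rV[K]_N.+1 -> Prop) (Q : 'rV[int]_k -> Prop) (B : R) :
  entries_le b T -> fibres_le X (fun v => v *m int_mx T) M ->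
  (forall c v, X v -> X (c *: v)) ->
  (forall x, on_variety Z x -> X (int_mx x)) ->
  (forall x (g : nat) w, on_variety Z x -> (0 < g)%N -> x *m T = g%:Z *: w -> Q w) ->
  (count_variety Z B <= M * #|` fset_set [set w : 'rV[int]_k |
     [/\ Q w, primitive w & ((height w)%:R <= (N.+1 * b)%:R * B)%R]] |)%N.
Proof.
move=> bT fT scaleX onX hQ; rewrite /count_variety.
set E := [set x | _]; set Wset := [set w | _].
have finE : finite_set E.
  by apply: (sub_finite_set _ (finite_height N.+1 B)) => x [].
have finW : finite_set Wset.
  by apply: (sub_finite_set _ (finite_height k ((N.+1 * b)%:R * B))) => x [].
(* One primitive representative for each projective point, with default 0 away from the counted
   set. *)
pose rep v := xget 0 [set x | E x /\ proj_pt x = v].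
have repP v : v \in fset_set [set proj_pt x | x in E] -> E (rep v) /\ proj_pt (rep v) = v.
  rewrite in_fset_set; last exact: finite_image.
  rewrite inE => -[x Ex e]; rewrite /rep; case: xgetP => [y _ //|/(_ x)].
  by case.
have z0 x : E x -> x *m T != 0.
  move=> [xZ px _]; apply/eqP => xT.
  have x0 : int_mx x != 0.
    apply: contraTneq px => e; have -> : x = 0.
      apply/rowP => i; have := congr1 (fun v : 'rV[K]_N.+1 => v ord0 i) e.
      by rewrite !mxE => /eqP; rewrite intr_eq0 => /eqP.
    by rewrite /primitive big1 // => i _; rewrite mxE.
  (* All multiples of x would lie in the fibre over 0, which is finite. *)
  have := fT 0 [seq (c%:R : K) *: int_mx x | c <- iota 0 M.+1].
  rewrite size_map size_iota ltnn => h; suff : false by [].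
  apply: h => [|v /mapP[c _ ->]].
    rewrite map_inj_uniq ?iota_uniq // => c c' /eqP; rewrite -subr_eq0 -scalerBl scaler_eq0 (negPf x0) orbF subr_eq0.
    by rewrite eqr_nat => /eqP.
  split; first by apply/scaleX/onX.
  by rewrite -scalemxAl /int_mx -map_mxM xT map_mx0 scaler0.
have /choice[gw hgw] : forall z : 'rV[int]_k, exists gw : nat * 'rV[int]_k, z != 0 ->
    [/\ (0 < gw.1)%N, z = gw.1%:Z *: gw.2 & primitive gw.2].
  move=> z; have [->|zn0] := eqVneq z 0; first by exists (0%N, 0) => /eqP[].
  by have [g [w h]] := primitive_decomp zn0; exists (g, w).
pose g v := (gw (rep v *m T)).1; pose w v := (gw (rep v *m T)).2.
have gwP v : v \in fset_set [set proj_pt x | x in E] ->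
    [/\ (0 < g v)%N, rep v *m T = (g v)%:Z *: w v & primitive (w v)].
  by move=> /repP[/z0/hgw].
apply: (seq_fibres_le (f := w)); first exact: fset_uniq.
  move=> v vS; have [[xZ px hx] _] := repP v vS; have [g0 e pw] := gwP v vS.
  change (w v \in fset_set Wset); rewrite in_fset_set // inE; split=> //; first exact: (hQ _ _ _ xZ g0 e).
  have le : (height (w v) <= N.+1 * b * height (rep v))%N.
    apply: leq_trans (height_mulmx (rep v) bT); rewrite e; apply: height_le => i.
    apply: leq_trans (height_ge _ i); rewrite mxE abszM absz_nat.
    by rewrite leq_pmull.
  apply: le_trans (_ : (N.+1 * b * height (rep v))%:R <= _); first by rewrite ler_nat.
  by rewrite natrM ler_wpM2l.
move=> w0 l ul hl.
(* Dividing by g puts all representatives in the fibre over w0. If two quotients agree, the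
   representatives are proportional and the points coincide. *)
pose u v : 'rV[K]_N.+1 := (g v)%:R^-1 *: int_mx (rep v).
rewrite -(size_map u); apply: (fT (int_mx w0)).
  rewrite map_inj_in_uniq // => v v' vl v'l.
  have [vS _] := hl v vl; have [v'S _] := hl v' v'l.
  have [g0 _ _] := gwP v vS; have [g'0 _ _] := gwP v' v'S.
  have [_ ev] := repP v vS; have [_ ev'] := repP v' v'S => e.
  suff : proj_pt (rep v) = proj_pt (rep v') by rewrite ev ev'.
  apply: (proj_pt_eq g0 g'0); apply/rowP => i; apply/eqP.
  rewrite !mxE -(eqr_int K) !rmorphM /= -!pmulrn.
  have := congr1 (fun v : 'rV[K]_N.+1 => v ord0 i) e; rewrite !mxE => e'.
  have gK : (g v)%:R != 0 :> K by rewrite pnatr_eq0 -lt0n.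
  have g'K : (g v')%:R != 0 :> K by rewrite pnatr_eq0 -lt0n.
  rewrite -[X in _ * X == _](mulVKf gK) e' mulrCA mulVKf //.
move=> _ /mapP[v vl ->]; have [vS wv] := hl v vl.
have [g0 e _] := gwP v vS; have [[xZ _ _] _] := repP v vS.
split; first by apply/scaleX/onX.
rewrite /u -scalemxAl /int_mx -map_mxM e map_mxZ /= scalerA -pmulrn mulVf ?scale1r ?wv //.
by rewrite pnatr_eq0 -lt0n.
Qed.

End CountProjection.

(** * An absolutely irreducible form containing a linear space of codimension two *)

Lemma rmorph_unit_cancel (R S : unitRingType) (f : {rmorphism R -> S}) (g : {rmorphism S -> R}) x :
  cancel f g -> f x \is a GRing.unit -> x \is a GRing.unit.
Proof. by move=> fK /(rmorph_unit g); rewrite fK. Qed.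

Lemma irreducible_transfer (R S : idomainType) (f : {rmorphism R -> S}) (g : {rmorphism S -> R}) p :
  cancel f g -> cancel g f -> irreducible_elt (f p) -> irreducible_elt p.
Proof.
move=> fK gK [p0 pU pI].
have unitE x : (f x \is a GRing.unit) = (x \is a GRing.unit).
  by apply/idP/idP => [/(rmorph_unit_cancel fK)|/(rmorph_unit f)].
split; first by apply: contra_neq p0 => ->; rewrite rmorph0.
  by rewrite -unitE.
by move=> a b e; rewrite -!unitE; apply: pI; rewrite e rmorphM.
Qed.

Section ToPolyTransfer.
Variables (F : fieldType) (m : nat) (p : {mpoly F[m.+1]}).

Let a : 'I_m -> F := fun=> 0.
Let f : {rmorphism {mpoly F[m.+1]} -> {poly {mpoly F[m]}}} := to_poly a.
Let g : {rmorphism {poly {mpoly F[m]}} -> {mpoly F[m.+1]}} := of_poly a.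
Let fK : cancel f g := to_polyK a.
Let gK : cancel g f := of_polyK a.

Lemma to_poly_unit : to_poly a p \is a GRing.unit -> p \is a GRing.unit.
Proof. exact: (@rmorph_unit_cancel {mpoly F[m.+1]} {poly {mpoly F[m]}} f g p fK). Qed.

Lemma to_poly_irreducible : irreducible_elt (to_poly a p) -> irreducible_elt p.
Proof. exact: (@irreducible_transfer {mpoly F[m.+1]} {poly {mpoly F[m]}} f g p fK gK). Qed.

End ToPolyTransfer.

(** By degrees, one of two factors is constant; it then divides both coefficients and is a unit. *)
Lemma linear_poly_irreducible (R : idomainType) (u v : R) : u != 0 ->
  (forall a, divides a u -> divides a v -> a \is a GRing.unit) ->
  irreducible_elt (u%:P * 'X + v%:P).
Proof.
move=> u0 cop; set p := _ + _.
have c1 : p`_1 = u by rewrite coefD coefCM coefX coefC mulr1 addr0.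
have c0 : p`_0 = v by rewrite coefD coefCM coefX coefC mulr0 add0r.
have sp : size p = 2%N by rewrite /p size_MXaddC polyC_eq0 (negPf u0) size_polyC u0.
have p0 : p != 0 by rewrite -size_poly_eq0 sp.
have unit1 a b : p = a * b -> size a = 1%N -> a \is a GRing.unit.
  move=> e sa; have ea := size1_polyC (eq_leq sa).
  rewrite poly_unitE sa eqxx /=; apply: cop.
    by exists b`_1; rewrite -c1 e {1}ea coefCM mulrC.
  by exists b`_0; rewrite -c0 e {1}ea coefCM mulrC.
split=> // [|a b e]; first by rewrite poly_unitE sp.
have : a * b != 0 by rewrite -e.
rewrite mulf_eq0 negb_or => /andP[a0 b0].
have := sp; rewrite e size_mul //; have := a0; have := b0; rewrite -!size_poly_gt0.
have [sa _ _ _|sa] := eqVneq (size a) 1%N; first by left; apply: (unit1 _ b).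
move=> sb0 sa0 ss; right; apply: (unit1 _ a); first by rewrite mulrC.
by move: (size a) (size b) sa sb0 sa0 ss => x y; lia.
Qed.

Lemma size_divisor_const (R : idomainType) (p q : {poly R}) :
  p * q != 0 -> (size (p * q)%R <= 1)%N -> size q = 1%N.
Proof.
rewrite mulf_eq0 negb_or => /andP[p0 q0]; rewrite size_mul //.
by move: p0 q0; rewrite -!size_poly_gt0; move: (size p) (size q) => x y; lia.
Qed.

Section LinearWitness.
Variables (r d : nat).

(** Linear in X_0, so that irreducibility reduces to coprime coefficients, and zero on X_0 = X_1 =
    0, which leaves r + 1 free coordinates. *)
Definition witness_form (R : comNzRingType) : {mpoly R[r.+3]} :=
  'X_(lift ord0 (lift ord0 ord0)) ^+ d.-1 * 'X_ord0 + 'X_(lift ord0 ord0) ^+ d.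

Lemma witness_form_homog R : (0 < d)%N -> witness_form R \is d.-homog.
Proof.
have hX (i : 'I_r.+3) m : ('X_i ^+ m : {mpoly R[r.+3]}) \is m.-homog.
  rewrite -[X in _ \is X.-homog]mul1n; apply: dhomogMn; rewrite dhomogX.
  by apply/eqP/mdeg1.
move=> d0; apply: rpredD; last exact: hX.
have := dhomogM (hX (lift ord0 (lift ord0 ord0)) d.-1) (hX ord0 1%N).
by rewrite expr1 [(d.-1 + 1)%N]addn1 (prednK d0).
Qed.

(** As a polynomial in X_0, a divisor of a power of X_1 is constant, and a constant dividing ['X^d]
    divides its leading coefficient 1. *)
Lemma monomials_coprime (F : fieldType) m e (a : {mpoly F[m.+2]}) :
  divides a ('X_(lift ord0 ord0) ^+ e) -> divides a ('X_ord0 ^+ d) ->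
  a \is a GRing.unit.
Proof.
pose f := to_poly (fun=> 0 : F) : {mpoly F[m.+2]} -> {poly {mpoly F[m.+1]}}.
move=> [b eb] [c ec].
have fb : f b * f a = ('X_ord0 ^+ e)%:P.
  rewrite -[LHS]rmorphM -eb rmorphXn /= to_polyX /to_poly_var liftK.
  by rewrite mpolyC0 mul0r addr0 polyC_exp.
have fc : f c * f a = 'X^d.
  by rewrite -[LHS]rmorphM -ec rmorphXn /= to_polyX /to_poly_var unlift_none.
have X0 : ('X_ord0 ^+ e)%:P != 0 :> {poly {mpoly F[m.+1]}}.
  by rewrite polyC_eq0 expf_eq0 -msize_poly_eq0 msizeX andbF.
have sa : size (f a) = 1%N.
  apply: (size_divisor_const (p := f b)); first by rewrite fb.
  by rewrite fb size_polyC_leq1.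
apply: to_poly_unit.
rewrite -/(f a) poly_unitE sa eqxx /=.
apply/unitrPr; exists (f c)`_d.
have := congr1 (fun p : {poly {mpoly F[m.+1]}} => p`_d) fc.
by rewrite coefXn eqxx {1}(size1_polyC (eq_leq sa)) coefMC mulrC.
Qed.

Lemma witness_form_abs_irreducible : abs_irreducible (witness_form int).
Proof.
have e : map_mpoly intr (witness_form int) = witness_form K.
  by rewrite /witness_form rmorphD rmorphM !rmorphXn /= !map_mpolyX.
rewrite /abs_irreducible e.
apply: to_poly_irreducible.
rewrite rmorphD rmorphM !rmorphXn /= !to_polyX /to_poly_var !liftK unlift_none.
rewrite !mpolyC0 !mul0r !addr0 -!polyC_exp; apply: linear_poly_irreducible.
  by rewrite expf_eq0 -msize_poly_eq0 msizeX andbF.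
by move=> a; apply: monomials_coprime.
Qed.

Definition embed_row (w : 'rV[int]_r.+1) : 'rV[int]_r.+3 := row_mx (0 : 'rV[int]_2) w.

Lemma embed_row_inj : injective embed_row.
Proof. by move=> w w' e; have [] := @eq_row_mx _ 1 2 r.+1 _ _ _ _ e. Qed.

Lemma primitive_embed w : primitive (embed_row w) = primitive w.
Proof.
rewrite /primitive (@big_split_ord _ _ _ 2 r.+1) big1 /= => [|i _].
  by rewrite gcd0n; congr (_ == _); apply: eq_bigr => i _; rewrite /embed_row (@row_mxEr _ 1 2 r.+1).
by rewrite /embed_row (@row_mxEl _ 1 2 r.+1) mxE.
Qed.

Lemma height_embed w : height (embed_row w) = height w.
Proof.
rewrite /height (@big_split_ord _ _ _ 2 r.+1) big1 /= => [|i _].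
  by rewrite max0n; apply: eq_bigr => i _; rewrite /embed_row (@row_mxEr _ 1 2 r.+1).
by rewrite /embed_row (@row_mxEl _ 1 2 r.+1) mxE.
Qed.

Lemma witness_form_embed w : (1 < d)%N -> (witness_form int).@[embed_row w ord0] = 0.
Proof.
move=> d1; rewrite /witness_form mevalD mevalM !rmorphXn /= !mevalXU.
have e1 : lift ord0 ord0 = lshift r.+1 (lift ord0 ord0 : 'I_2) :> 'I_r.+3 by apply: val_inj.
have e0 : embed_row w ord0 ord0 = 0.
  rewrite (_ : (ord0 : 'I_r.+3) = lshift r.+1 (ord0 : 'I_2)); last exact: val_inj.
  by rewrite /embed_row (@row_mxEl _ 1 2 r.+1) mxE.
have v1 : embed_row w ord0 (lift ord0 ord0) = 0.
  by rewrite e1 /embed_row (@row_mxEl _ 1 2 r.+1) mxE.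
rewrite e0 v1 mulr0 add0r.
by rewrite expr0n; case: d d1.
Qed.

End LinearWitness.

Section Cones.
Variables (N : nat) (Z : variety N).

Lemma cone_scale c v : cone Z v -> cone Z (c *: v).
Proof.
move=> cv p pZ; rewrite (pihomog_partitionE (leqnn (msize p))) raddf_sum big1 // => i _ /=.
have -> : (pihomog mdeg i p).@[(c *: v) ord0] = (pihomog mdeg i p).@[fun j => c * v ord0 j].
  by apply: meval_eq => j; rewrite mxE.
by rewrite (meval_homog _ _ (pihomogP mdeg i p)) cv ?mulr0 //; apply: variety_pihomog.
Qed.

Lemma on_variety_cone x : on_variety Z x -> cone Z (int_mx x).
Proof. by move=> h p /h <-; apply: meval_eq => i; rewrite mxE. Qed.

Lemma vanishes_at_intE m (F : {mpoly K[m]}) x : vanishes_at_int F x <-> F.@[int_mx x ord0] = 0.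
Proof. by rewrite /vanishes_at_int (meval_eq (v2 := int_mx x ord0)) // => i; rewrite mxE. Qed.

End Cones.

Section CountBounds.
Variables (R : realType) (N r d : nat) (Z : variety N).
Local Open Scope classical_set_scope.

Lemma count_primitive_le (B : R) : (1 < d)%N ->
  (#|` fset_set [set w : 'rV[int]_r.+1 | [/\ True, primitive w & ((height w)%:R <= B)%R]] |
   <= count_form (witness_form r d int) B)%N.
Proof.
move=> d1; rewrite /count_form; set W := [set w | _]; set W' := [set x | _].
have finW : finite_set W.
  by apply: (sub_finite_set _ (finite_height r.+1 B)) => x [].
have finW' : finite_set W'.
  by apply: (sub_finite_set _ (finite_height r.+3 B)) => x [].
rewrite -(size_map (@embed_row r)); apply: uniq_leq_size.
  by rewrite map_inj_uniq ?fset_uniq //; apply: embed_row_inj.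
move=> _ /mapP[w ww ->]; change (embed_row w \in fset_set W').
have {ww} : w \in fset_set W := ww.
rewrite !in_fset_set // !inE => -[_ pw hw]; split.
- exact: witness_form_embed.
- by rewrite primitive_embed.
- by rewrite height_embed.
Qed.

Variables (b M : nat) (U : 'M[int]_(N.+1, r.+3)) (F : {mpoly K[r.+3]}).
Hypotheses (bU : entries_le b U) (fU : fibres_le (cone Z) (fun v => v *m int_mx U) M).
Hypotheses (homF : F \is d.-homog) (FZ : subst_mx (int_mx U) F \in Z).

Lemma vanishes_at_image x : on_variety Z x -> vanishes_at_int F (x *m U).
Proof.
move=> /on_variety_cone cx; apply/vanishes_at_intE.
by rewrite /int_mx map_mxM; apply: cone_subst cx.
Qed.

(** F vanishes at x U = g w, and by homogeneity the factor g^d can be cancelled, so the primitive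
    vector w is itself a zero. *)
Lemma count_variety_rational (F' : {mpoly int[r.+3]}) (B : R) :
  (forall x, vanishes_at_int F x -> F'.@[x ord0] = 0) ->
  (count_variety Z B <= M * count_form F' ((N.+1 * b)%:R * B)%R)%N.
Proof.
move=> hF'; apply: (@count_projection R N Z _ U b M (cone Z) (fun w => F'.@[w ord0] = 0)) => //.
- by move=> c v; apply: cone_scale.
- by move=> x; apply: on_variety_cone.
move=> x g w xZ g0 e; apply: hF'; apply/vanishes_at_intE.
have /vanishes_at_intE := vanishes_at_image xZ.
rewrite e => h; have gK : (g%:R : K) ^+ d != 0 by rewrite expf_neq0 // pnatr_eq0 -lt0n.
apply: (mulfI gK); rewrite mulr0 -h -(meval_homog _ _ homF); apply: meval_eq => i.
by rewrite !mxE rmorphM /= -pmulrn.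
Qed.

(** After the two further projections no equation is kept: the images are merely primitive vectors
    with r + 1 coordinates, and these embed in the zeros of [witness_form]. *)
Lemma count_variety_irrational m0 (G : {mpoly K[r.+3]}) (B : R) : (1 < d)%N ->
  (d + d <= m0)%N ->
  ((second_difference r.+2 d d).[m0%:R] < 'C(m0 + r.+1, r.+1)%:R)%R ->
  irreducible_elt F -> G \is d.-homog -> ~ divides F G ->
  (forall x, vanishes_at_int F x -> vanishes_at_int G x) ->
  (count_variety Z B <= m0 * d * M *
     count_form (witness_form r d int) ((N.+1 * (b * d.+1 * m0.+1))%:R * B)%R)%N.
Proof.
move=> d1 dm lt irrF homG nFG FG.
have [T bT [P [TE fP]]] := two_step_projection dm lt homF homG irrF nFG bU.
apply: leq_trans (leq_mul (leqnn _) (count_primitive_le _ d1)).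
pose X (v : 'rV[K]_N.+1) := cone Z v /\ G.@[(v *m int_mx U) ord0] = 0.
apply: (@count_projection R N Z _ T _ _ X (fun=> True)) => //.
- have fX : fibres_le X (fun v => v *m int_mx U) M.
    by move=> w s us hs; apply: (fU us) => v /hs[[cv _] e]; split; [exact: cv | exact: e].
  have XFG v : X v -> F.@[(v *m int_mx U) ord0] = 0 /\ G.@[(v *m int_mx U) ord0] = 0.
    by move=> [cv Gv]; split=> //; apply: cone_subst cv.
  apply: (fibres_le_mono _ _ (leqnn _) (fibres_le_comp XFG fX fP)) => // v.
  by rewrite /= TE /int_mx map_mxM mulmxA.
- move=> c v [cv Gv]; split; first exact: cone_scale.
  rewrite -scalemxAl (meval_eq (v2 := fun i => c * (v *m int_mx U) ord0 i)) => [|i]; last by rewrite mxE.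
  by rewrite (meval_homog _ _ homG) Gv mulr0.
- move=> x xZ; split; first exact: on_variety_cone.
  by have /FG/vanishes_at_intE := vanishes_at_image xZ; rewrite /int_mx map_mxM.
Qed.

End CountBounds.

(** * Uniform constants and the final estimate *)

Lemma powR_count_bound (R : realType) (C t B : R) (c M n k : nat) :
  (0 < c)%N -> 1 <= B -> (n <= M * k)%N ->
  (forall B' : R, 1 <= B' -> B' = c%:R * B -> k%:R <= C * B' `^ t) ->
  n%:R <= M%:R * C * c%:R `^ t * B `^ t.
Proof.
move=> c0 B1 nMk hk.
have cB : 1 <= c%:R * B by rewrite mulr_ege1 // ler1n.
apply: le_trans (_ : (M * k)%:R <= _); first by rewrite ler_nat.
rewrite natrM -!mulrA ler_wpM2l // -powRM ?(le_trans ler01) //.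
- exact: hk.
- by rewrite ler1n.
Qed.

Theorem theorem1 (R : realType) (d n : nat) (hd : (2 <= d)%N) (hn : (2 <= n)%N)
    (theta : R)
    (Htheta : forall eps : R, 0 < eps ->
       exists C : R, forall F : {mpoly int[n.+1]},
         F \is d.-homog -> abs_irreducible F ->
         forall B : R, 1 <= B ->
           (count_form F B)%:R <= C * B `^ (theta + eps)) :
  forall eps : R, 0 < eps ->
  forall N : nat,
  exists C : R, forall Z : variety N,
    geom_integral Z -> has_degree Z d -> has_dim Z n.-1 ->
    forall B : R, 1 <= B ->
      (count_variety Z B)%:R <= C * B `^ (theta + eps).
Proof.
move=> eps eps0 N; have [C0 hC0] := Htheta eps eps0.
(* From here on n = r + 2: Z has dimension r + 1 and the forms have r + 3 variables. *)
case: n hn Htheta hC0 => [|[|r]] // _ _ hC0; set t := theta + eps in hC0 *.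
have d0 : (0 < d)%N by apply: leq_trans hd.
have [m0 dm lt] := elimination_degree r.+1 d.
pose M := (d ^ N)%N; pose b := maxn (d.+1 ^ N) M.
have b0 : (0 < b)%N by rewrite leq_max expn_gt0.
pose CA : R := M%:R * C0 * (N.+1 * b)%:R `^ t.
pose CB : R := (m0 * d * M)%:R * C0 * (N.+1 * (b * d.+1 * m0.+1))%:R `^ t.
(* Which case occurs depends on Z, hence the maximum. The numbers M, b and m0 are fixed before Z and
   depend only on d, n and N. *)
exists (Num.max CA CB) => Z intZ degZ dimZ B B1.
have asymp := has_dim_degree_asymp d0 degZ dimZ.
have [T hT] := bounded_noether intZ asymp d0.
have [U [F [bU fU homF irrF FZ]]] := birational_hypersurface intZ asymp d0 hT.
have Bt : 0 <= B `^ t by apply: powR_ge0.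
have [[F' [homF' irrF' hF']]|[G [homG nFG hG]]] := rational_dichotomy homF irrF.
  apply: le_trans (_ : CA * B `^ t <= _); last by rewrite ler_wpM2r // le_max lexx.
  apply: powR_count_bound (count_variety_rational bU fU homF FZ B hF') _ => //.
    by rewrite muln_gt0.
  by move=> B' B'1 <-; apply: hC0.
apply: le_trans (_ : CB * B `^ t <= _); last by rewrite ler_wpM2r // le_max lexx orbT.
apply: powR_count_bound (count_variety_irrational bU fU homF FZ B hd dm lt irrF homG nFG hG) _ => //.
  by rewrite !muln_gt0 b0.
move=> B' B'1 <-; apply: hC0 => //; first exact: witness_form_homog.
exact: witness_form_abs_irreducible.
Qed.
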